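(* Let $(p_j)_{j\in\mathbb Z}$ satisfy $0<p_j\le 1/2$ for all $j$ and $\min_{j\in\mathbb Z}p_j<1/2$, and let $\mathbf C(N)=(C_1(N),C_2(N))$, $N=0,1,2,\ldots$, be the anisotropic random walk on $\mathbb Z^2$ with $\mathbf C(0)=(0,0)$ associated with $(p_j)$. Suppose that (i) there are constants $1<\gamma<\infty$ and $1/2<\eta<\infty$ such that, as $n\to\infty$, $$n^{-1}\sum_{j=1}^n p_j^{-1}=2\gamma+o(n^{-\eta}),\qquad n^{-1}\sum_{j=1}^n p_{-j}^{-1}=2\gamma+o(n^{-\eta});$$ (ii) there is an $\omega>0$ such that $p_j\ge\omega$ for all $j\in\mathbb Z$; (iii) $$\sup_{n\ge 0}\sqrt n\,\sup_{N\ge n}\sum_{m=n}^N\left(\mathbf P(C_2(2m+2)=0)-\mathbf P(C_2(2m+1)=0)\right)<\infty.$$ Then $$\mathbf P(\mathbf C(2N)=(0,0))\sim\frac{1}{4Np_0\pi\sqrt{\gamma-1}},\qquad N\to\infty,$$ i.e. the ratio of the two sides tends to $1$.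
   Context: The anisotropic random walk associated with $(p_j)_{j\in\mathbb Z}$ is the Markov chain $\mathbf C(N)=(C_1(N),C_2(N))$ on $\mathbb Z^2$, started at $\mathbf C(0)=(0,0)$, with transition probabilities, for $(k,j)\in\mathbb Z^2$ and $N\ge 0$, $$\mathbf P(\mathbf C(N+1)=(k\pm1,j)\mid \mathbf C(N)=(k,j))=\tfrac12-p_j,\qquad \mathbf P(\mathbf C(N+1)=(k,j\pm1)\mid \mathbf C(N)=(k,j))=p_j$$ (each of the four signs/neighbors having the indicated probability). *)

(* Defs.v *)
From HB Require Import structures.
From mathcomp Require Import all_boot all_order all_algebra.
From mathcomp Require Import all_classical all_reals all_analysis.

Set Implicit Arguments.
Unset Strict Implicit.
Unset Printing Implicit Defensive.

Import Order.TTheory GRing.Theory Num.Theory.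
Import numFieldNormedType.Exports.

Local Open Scope classical_set_scope.
Local Open Scope ring_scope.

Definition Pr (d : measure_display) (T : measurableType d) (R : realType)
    (P : probability T R) (A : set T) : R := fine (P A).

(* Only meaningful when [Pr P B] is nonzero. *)
Definition condPr (d : measure_display) (T : measurableType d) (R : realType)
    (P : probability T R) (A B : set T) : R :=
  Pr P (A `&` B) / Pr P B.

Section MarkovChain.
Context (d : measure_display) (T : measurableType d) (R : realType).
Variables (P : probability T R) (S : countType).

(* As [S] is countable, the first clause is measurability of each [X N] for
   the discrete sigma-algebra on [S]. *)
Definition is_markov_chain (Q : S -> S -> R) (s0 : S) (X : nat -> T -> S) :=
  [/\ forall N s, measurable (X N @^-1` [set s]),
      Pr P [set t | X 0%N t = s0] = 1
    & forall (N : nat) (x : nat -> S) (y : S),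
        let past := [set t | forall n, (n <= N)%N -> X n t = x n] in
        0 < Pr P past ->
        condPr P [set t | X N.+1 t = y] past = Q (x N) y].

End MarkovChain.

(* Points of the lattice are pairs [(k, j)]; the parameter [p j] depends on the
   second coordinate, and is the probability of each of the two steps that
   change the second coordinate. *)
Definition aniso_step (R : realType) (p : int -> R) (a b : int * int) : R :=
  let: (k, j) := a in
  if (b == (k + 1, j)) || (b == (k - 1, j)) then 2^-1 - p j
  else if (b == (k, j + 1)) || (b == (k, j - 1)) then p j
  else 0.

Definition anisotropic_walk (d : measure_display) (T : measurableType d)
    (R : realType) (P : probability T R) (p : int -> R)
    (C : nat -> T -> int * int) : Prop :=
  is_markov_chain P (aniso_step p) (0, 0) C.

(* Main.v *)
Require Import Defs.
From HB Require Import structures.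
From mathcomp Require Import all_boot all_order all_algebra.
From mathcomp Require Import all_classical all_reals all_analysis.
From mathcomp Require Import ring lra zify.

Set Implicit Arguments.
Unset Strict Implicit.
Unset Printing Implicit Defensive.

Import Order.TTheory GRing.Theory Num.Theory.
Import numFieldNormedType.Exports.

Local Open Scope classical_set_scope.
Local Open Scope ring_scope.

(** Write [C2] for the vertical coordinate, [H n] for the number of horizontal
    steps among the first [n] steps, [u n] for the probability of [C2 n = 0],
    and [kappa = 1 - 1 / gamma].  Given the vertical motion, the horizontal
    coordinate is a simple random walk run for [H] steps, so the probability of
    being at the origin at time [2 N] is the expectation of [ret (H (2 N))] on
    the event [C2 (2 N) = 0], where [ret h] is the return probability of the
    simple walk ([Pr_origin]).  Since [ret (2 k)] is equivalent to
    [1 / sqrt (pi * k)] by Wallis' product ([ret_cvg]), the theorem follows from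
    three facts: [u (2 N)] is equivalent to
    [1 / (4 * p 0 * sqrt (pi * gamma * N))] ([return_cvg]); on the event
    [C2 (2 N) = 0], [H (2 N)] is close to [2 * kappa * N]
    ([horizontal_concentration]); and the paths with few horizontal steps
    contribute little ([few_horizontal]).

    The measure with weights [1 / p j] is reversible for [C2].  This makes the
    even return probabilities nonincreasing and at least equal to the odd ones
    that follow them and, as [p] is bounded below, bounds the heat kernel by a
    multiple of [1 / sqrt n], uniformly in the starting point ([vert_even_sup]).

    Let [phi] be a function on the integers whose second difference is
    [1 / p j - 2 * gamma].  As [1 / p j] has mean [2 * gamma] on both half-lines,
    the slope of [phi] is sublinear; since [C2 n] is of order [sqrt n],
    [H n - kappa * n - phi (C2 n) / gamma] is then a martingale with increments
    [o(sqrt n)], and [H n] is [kappa * n + o(n)] in mean ([count_mean]).  A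
    variant of [phi] with positive mean curvature, hence bounded below, gives
    a supermartingale that bounds the expectation of any nonincreasing function
    of [H n] ([count_small_horizontal]).  Both estimates are transferred to the
    event [C2 (2 N) = 0] by splitting the path in two and bounding the second
    part by the heat kernel ([count_split], [vert_sup]).

    For the return probabilities, [2 * p 0 * (u 0 + ... + u (n - 1))] is the
    mean of [|C2 n|] ([vert_abs]).  The vertical steps form a simple random
    walk, and about [n / gamma] of them are taken in time [n], so this mean is
    close to that of the simple walk at time [n / gamma] ([vert_abs_close]),
    which is known exactly ([mean_abs_zero]).  The hypothesis that compares even
    and odd times implies that the even and the odd terms contribute the same to
    the sum up to a bounded error ([even_odd_bounded]), and since the even terms
    are monotone their asymptotics can be read off their sums
    ([monotone_sqrt_density]). *)

(** * Averaging operators *)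

Section Averaging.
Variables (R : realType) (X : Type) (p : X -> R) (s0 s1 s2 : X -> X).

(** One step of a chain on [X] that moves by [s1] or [s2] with probability [p x]
    each, and by [s0] otherwise.  The same operator covers the vertical
    coordinate, the simple walk, and the vertical coordinate together with a
    counter of horizontal steps. *)
Definition avg (f : X -> R) (x : X) : R :=
  (1 - 2 * p x) * f (s0 x) + p x * (f (s1 x) + f (s2 x)).

Definition expect (n : nat) (f : X -> R) : X -> R := iter n avg f.

Arguments expect : simpl never.
Arguments avg : simpl never.

Lemma expectS n f : expect n.+1 f = avg (expect n f).
Proof. by []. Qed.

Lemma expectSr n f : expect n.+1 f = expect n (avg f).
Proof. exact: iterSr. Qed.

Lemma expect_add m n f : expect (m + n) f = expect m (expect n f).
Proof. exact: iterD. Qed.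

Lemma expectD n f g x :
  expect n (fun y => f y + g y) x = expect n f x + expect n g x.
Proof. by elim: n x => [//|n IH] x; rewrite !expectS /avg !IH; ring. Qed.

Lemma expectZ n c f x : expect n (fun y => c * f y) x = c * expect n f x.
Proof. by elim: n x => [//|n IH] x; rewrite !expectS /avg !IH; ring. Qed.

Lemma expect_cst n c x : expect n (fun=> c) x = c.
Proof. by elim: n x => [//|n IH] x; rewrite !expectS /avg !IH; ring. Qed.

Lemma eq_expect n f g x : f =1 g -> expect n f x = expect n g x.
Proof. by move=> fg; rewrite (funext fg). Qed.

Lemma expect_telescope n f x :
  expect n f x = f x + \sum_(m < n) expect m (fun y => avg f y - f y) x.
Proof.
elim: n => [|n IH]; first by rewrite big_ord0 addr0.
rewrite big_ord_recr /= addrA -IH expectSr.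
rewrite -expectD; apply: eq_expect => y; ring.
Qed.

Hypothesis p_ge0 : forall x, 0 <= p x.
Hypothesis p_le2 : forall x, p x <= 2^-1.

(** Inequalities between functions are only available at points that the chain
    can reach, hence the time-dependent invariant. *)
Section Invariant.
Variable I : nat -> X -> Prop.
Hypothesis Istep : forall m x,
  I m x -> [/\ I m.+1 (s0 x), I m.+1 (s1 x) & I m.+1 (s2 x)].

Lemma ler_expect_inv m n f g x : I m x ->
  (forall y, I (m + n) y -> f y <= g y) -> expect n f x <= expect n g x.
Proof.
elim: n m x => [|n IH] m x Imx fg; first by apply: fg; rewrite addn0.
have [I0 I1 I2] := Istep Imx.
rewrite !expectS /avg.
have le i : I m.+1 i -> expect n f i <= expect n g i.
  by move=> Ii; apply: (IH m.+1) => // y; rewrite addSnnS; exact: fg.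
apply: lerD.
- by apply: ler_wpM2l; [have := p_le2 x; lra | exact: le].
- by apply: ler_wpM2l => //; apply: lerD; exact: le.
Qed.

(** A bound on the drift of a space-time function bounds its expectation: this is
    how the supermartingales below are used. *)
Lemma expect_drift (F c : nat -> X -> R) n x : I 0%N x ->
  (forall m y, (m < n)%N -> I m y -> avg (F m.+1) y <= F m y + c m y) ->
  expect n (F n) x <= F 0%N x + \sum_(m < n) expect m (c m) x.
Proof.
move=> I0x; elim: n => [|n IH] dr; first by rewrite big_ord0 addr0.
rewrite big_ord_recr /= addrA.
apply: le_trans (_ : expect n (F n) x + expect n (c n) x <= _); last first.
  by rewrite lerD2r; apply: IH => m y mn; apply: dr; exact: ltnW.
rewrite expectSr -expectD; apply: (ler_expect_inv (m := 0%N)) => // y.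
by rewrite add0n => /dr; exact.
Qed.

End Invariant.

Lemma ler_expect n f g x : (forall y, f y <= g y) -> expect n f x <= expect n g x.
Proof.
by move=> fg; apply: (@ler_expect_inv (fun _ _ => True) _ 0%N).
Qed.

Lemma expect_ge0 n f x : (forall y, 0 <= f y) -> 0 <= expect n f x.
Proof. by move=> f0; rewrite -(expect_cst n 0 x); exact: ler_expect. Qed.

(** Jensen's inequality; the gap is the variance of [f] over the three moves. *)
Lemma avg_sqr_le f x : avg f x ^+ 2 <= avg (fun y => f y ^+ 2) x.
Proof.
rewrite -subr_ge0.
have -> : avg (fun y => f y ^+ 2) x - avg f x ^+ 2 =
  p x * (1 - 2 * p x) * ((f (s0 x) - f (s1 x)) ^+ 2 + (f (s0 x) - f (s2 x)) ^+ 2)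
  + p x ^+ 2 * (f (s1 x) - f (s2 x)) ^+ 2 by rewrite /avg; ring.
have ? := p_ge0 x; have ? := p_le2 x.
apply: addr_ge0; apply: mulr_ge0; rewrite ?sqr_ge0 //.
  by apply: mulr_ge0 => //; lra.
by apply: addr_ge0; exact: sqr_ge0.
Qed.

Lemma expect_sqr_le n f x : expect n f x ^+ 2 <= expect n (fun y => f y ^+ 2) x.
Proof.
elim: n x => [//|n IH] x; rewrite !expectS.
apply: le_trans (avg_sqr_le _ _) _.
exact: (ler_expect 1).
Qed.

Lemma expect_abs_le n f x : `|expect n f x| <= expect n (fun y => `|f y|) x.
Proof.
rewrite ler_norml; apply/andP; split; last by apply: ler_expect => y; exact: ler_norm.
rewrite lerNl -mulN1r -expectZ; apply: ler_expect => y.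
by rewrite mulN1r -normrN; exact: ler_norm.
Qed.

Lemma expect_le_sqrt n f x c :
  expect n (fun y => f y ^+ 2) x <= c -> expect n f x <= Num.sqrt c.
Proof.
move=> fc; apply: le_trans (ler_norm _) _.
by rewrite -sqrtr_sqr; apply: ler_wsqrtr; apply: le_trans fc; exact: expect_sqr_le.
Qed.

End Averaging.
Arguments avg : simpl never.
Arguments expect : simpl never.

Lemma expect_map (R : realType) (X Y : Type) (p : X -> R) (q : Y -> R)
    (s0 s1 s2 : X -> X) (t0 t1 t2 : Y -> Y) (h : X -> Y) (f : Y -> R) n x :
  (forall x, p x = q (h x)) -> (forall x, h (s0 x) = t0 (h x)) ->
  (forall x, h (s1 x) = t1 (h x)) -> (forall x, h (s2 x) = t2 (h x)) ->
  expect p s0 s1 s2 n (fun x => f (h x)) x = expect q t0 t1 t2 n f (h x).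
Proof.
move=> hp h0 h1 h2; elim: n x => [//|n IH] x.
by rewrite !expectS /avg !IH hp h0 h1 h2.
Qed.

(** * The vertical coordinate: reversibility and heat kernel *)

Section Vertical.
Variable R : realType.

Definition vavg (p : int -> R) := avg p id (fun j => j + 1) (fun j => j - 1).

Definition vert (p : int -> R) :=
  expect p id (fun j => j + 1) (fun j => j - 1).

Definition delta (a j : int) : R := (j == a)%:R.

Definition vanish_off (M : nat) (f : int -> R) :=
  forall j : int, M%:Z <= `|j| -> f j = 0.

(** Everything below has finite support, so sums over the integers are taken over
    a box that contains the supports with some room; shifts are then harmless. *)
Definition boxsum (M : nat) (f : int -> R) : R :=
  \sum_(0 <= k < (2 * M).+1) f (k%:Z - M%:Z).

Lemma boxsumD M f g : boxsum M (fun j => f j + g j) = boxsum M f + boxsum M g.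
Proof. exact: big_split. Qed.

Lemma boxsumN M f : boxsum M (fun j => - f j) = - boxsum M f.
Proof. by rewrite /boxsum sumrN. Qed.

Lemma boxsumZ M c f : boxsum M (fun j => c * f j) = c * boxsum M f.
Proof. by rewrite /boxsum mulr_sumr. Qed.

Lemma eq_boxsum M f g : f =1 g -> boxsum M f = boxsum M g.
Proof. by move=> fg; rewrite (funext fg). Qed.

Lemma ler_boxsum M f g : (forall j, f j <= g j) -> boxsum M f <= boxsum M g.
Proof. by move=> fg; apply: ler_sum => k _. Qed.

Lemma boxsum_succ M f : vanish_off M f ->
  boxsum M (fun j => f (j + 1)) = boxsum M f.
Proof.
move=> f0; rewrite /boxsum.
rewrite [RHS]big_nat_recl // [LHS]big_nat_recr //=.
rewrite [f (0%:Z - _)]f0; last by lia.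
rewrite [f (_ - _ + 1)]f0; last by lia.
rewrite add0r addr0; apply: eq_bigr => k _; congr f; lia.
Qed.

Lemma boxsum_pred M f : vanish_off M f ->
  boxsum M (fun j => f (j - 1)) = boxsum M f.
Proof.
move=> f0; rewrite /boxsum.
rewrite [LHS]big_nat_recl // [RHS]big_nat_recr //=.
rewrite [f (0%:Z - _ - _)]f0; last by lia.
rewrite [f (_ - _)]f0; last by lia.
rewrite add0r addr0; apply: eq_bigr => k _; congr f; lia.
Qed.

Lemma boxsum_delta M a f : `|a| <= M%:Z -> boxsum M (fun j => delta a j * f j) = f a.
Proof.
move=> aM; rewrite /boxsum (bigD1_seq (absz (a + M%:Z))) ?iota_uniq //=; last first.
  by rewrite mem_index_iota; lia.
rewrite big1 ?addr0.
  rewrite /delta (_ : _ - _ = a); last by lia.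
  by rewrite eqxx mul1r.
move=> k ka; rewrite /delta (_ : _ == a = false) ?mul0r //.
by apply/negbTE/eqP => ?; move/eqP: ka; apply; lia.
Qed.

Variable p : int -> R.
Hypothesis p_gt0 : forall j, 0 < p j.
Hypothesis p_le2 : forall j, p j <= 2^-1.

Let p_ge0 j : 0 <= p j. Proof. exact: ltW. Qed.
Let p_neq0 j : p j != 0. Proof. exact: lt0r_neq0. Qed.

Lemma vert_support n a b : (n%:Z < `|b - a|) -> vert p n (delta a) b = 0.
Proof.
elim: n b => [|n IH] b nb.
  by rewrite /vert /expect /= /delta; case: eqP => // ba; lia.
rewrite /vert expectS /avg.
by rewrite [X in _ * X]IH ?[X in _ * (X + _)]IH ?[X in _ * (_ + X)]IH; [ring|lia..].
Qed.

Lemma vert_vanish M n a : `|a| + n%:Z < M%:Z -> vanish_off M (vert p n (delta a)).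
Proof. by move=> aM j Mj; apply: vert_support; lia. Qed.

(** The weights [1 / p j] are reversible: each edge has conductance [1]. *)
Definition dot M (f g : int -> R) : R := boxsum M (fun j => f j * g j / p j).

(** The symmetric form of the pairing, from which self-adjointness and the
    energy identity are read. *)
Lemma dot_avg M f g : vanish_off M f -> vanish_off M g ->
  dot M f (vavg p g) =
  boxsum M (fun j => ((p j)^-1 - 2) * (f j * g j)) +
  (boxsum M (fun j => f j * g (j + 1)) + boxsum M (fun j => f (j + 1) * g j)).
Proof.
move=> f0 g0; rewrite /dot.
have -> : boxsum M (fun j => f (j + 1) * g j) = boxsum M (fun j => f j * g (j - 1)).
  rewrite -(@boxsum_pred M (fun j => f (j + 1) * g j)); last first.
    by move=> j Mj; rewrite [g j]g0 // mulr0.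
  by apply: eq_boxsum => j; rewrite subrK.
rewrite -!boxsumD; apply: eq_boxsum => j; rewrite /vavg /avg.
by field.
Qed.

Lemma dotC M f g : dot M f g = dot M g f.
Proof. by apply: eq_boxsum => j; rewrite (mulrC (f j)). Qed.

Lemma dot_selfadj M f g : vanish_off M f -> vanish_off M g ->
  dot M f (vavg p g) = dot M (vavg p f) g.
Proof.
move=> f0 g0; rewrite [RHS]dotC !dot_avg //; congr (_ + _).
  by apply: eq_boxsum => j; rewrite (mulrC (f j)).
by rewrite addrC; congr (_ + _); apply: eq_boxsum => j; rewrite mulrC.
Qed.

(** The difference is the Dirichlet energy, the sum of
    [(f (j + 1) - f j) ^+ 2]. *)
Lemma dot_avg_le M f : vanish_off M f -> dot M f (vavg p f) <= dot M f f.
Proof.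
move=> f0; rewrite dot_avg // -subr_ge0.
have f1 : boxsum M (fun j => f (j + 1) ^+ 2) = boxsum M (fun j => f j ^+ 2).
  by apply: (@boxsum_succ M (fun j => f j ^+ 2)) => j /f0 ->; rewrite expr0n.
rewrite [X in 0 <= X](_ : _ = boxsum M (fun j => (f (j + 1) - f j) ^+ 2)).
  by apply: sumr_ge0 => k _; exact: sqr_ge0.
transitivity (boxsum M (fun j => 2 * f j ^+ 2) + - (boxsum M (fun j => f j * f (j + 1)) +
    boxsum M (fun j => f (j + 1) * f j))).
  rewrite opprD addrA; congr (_ + _); rewrite /dot -boxsumN -boxsumD.
  by apply: eq_boxsum => j; ring.
transitivity (boxsum M (fun j => f (j + 1) ^+ 2) + boxsum M (fun j => f j ^+ 2)
    + - (boxsum M (fun j => f j * f (j + 1)) + boxsum M (fun j => f (j + 1) * f j))).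
  congr (_ + _); rewrite f1 boxsumZ; ring.
by rewrite -!boxsumD -boxsumN -boxsumD; apply: eq_boxsum => j; ring.
Qed.

(** Jensen's inequality, integrated against the invariant weights. *)
Lemma dot_avg2_le M f : vanish_off M f ->
  dot M (vavg p f) (vavg p f) <= dot M f f.
Proof.
move=> f0; set g := fun j => f j ^+ 2.
have g0 : vanish_off M g by move=> j /f0; rewrite /g => ->; rewrite expr0n.
have -> : dot M f f = boxsum M (fun j => vavg p g j / p j).
  rewrite (eq_boxsum _ (g := fun j => ((p j)^-1 - 2) * g j + (g (j + 1) + g (j - 1)))); last first.
    by move=> j; rewrite /vavg /avg; field.
  rewrite !boxsumD boxsum_succ // boxsum_pred // -!boxsumD.
  by apply: eq_boxsum => j; rewrite /g; field.
apply: ler_boxsum => j; rewrite -expr2 ler_pM2r ?invr_gt0 //.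
exact: avg_sqr_le.
Qed.

Lemma dot_vert M m n a b : `|a| + m%:Z < M%:Z -> `|b| + (m + n)%:Z < M%:Z ->
  dot M (vert p m (delta a)) (vert p n (delta b)) = vert p (m + n) (delta b) a / p a.
Proof.
elim: m n => [|m IH] n aM bM.
  rewrite /dot (eq_boxsum _ (g := fun j => delta a j * (vert p n (delta b) j / p j))).
    by rewrite boxsum_delta //; lia.
  by move=> j; rewrite mulrA.
rewrite {1}/vert expectS -/(vert p m (delta a)) -dot_selfadj; first last.
- by apply: vert_vanish; lia.
- by apply: vert_vanish; lia.
by rewrite -[vavg p _]/(vert p n.+1 (delta b)) IH ?addnS ?addSn //; lia.
Qed.

Lemma vert_odd_le m a : vert p (2 * m).+1 (delta a) a <= vert p (2 * m) (delta a) a.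
Proof.
pose M := (absz a + 2 * m + 2)%N.
rewrite -(ler_pM2r (x := (p a)^-1)) ?invr_gt0 //.
rewrite mul2n -addnn -addnS -!(@dot_vert M); [|rewrite /M; lia..].
by rewrite {2}/vert expectS; apply: dot_avg_le; apply: vert_vanish; rewrite /M; lia.
Qed.

Lemma vert_even_decr m a :
  vert p (2 * m.+1) (delta a) a <= vert p (2 * m) (delta a) a.
Proof.
pose M := (absz a + 2 * m + 3)%N.
rewrite -(ler_pM2r (x := (p a)^-1)) ?invr_gt0 //.
rewrite !mul2n -!addnn -!(@dot_vert M); [|rewrite /M; lia..].
by rewrite /vert !expectS; apply: dot_avg2_le; apply: vert_vanish; rewrite /M; lia.
Qed.

(** The kernel at even times is a Gram matrix for [dot], so an off-diagonal entry
    is at most the mean of two diagonal ones. *)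
Lemma vert_even_amgm m a b :
  vert p (2 * m) (delta b) a / p a <=
  (vert p (2 * m) (delta a) a / p a + vert p (2 * m) (delta b) b / p b) / 2.
Proof.
pose M := (absz a + absz b + 2 * m + 3)%N.
rewrite !mul2n -!addnn -!(@dot_vert M); [|rewrite /M; lia..].
rewrite ler_pdivlMr // mulrC /dot -boxsumZ -boxsumD; apply: ler_boxsum => j.
set x := vert _ _ _ _; set y := vert _ _ _ _.
rewrite -mulrDl mulrA ler_pM2r ?invr_gt0 //.
by have := sqr_ge0 (x - y); nra.
Qed.

(** Tanaka's formula: [|j - a|] is harmonic off [a], and increases in mean by
    [2 * p a] at each visit to [a]. *)
Lemma vert_abs n a :
  vert p n (fun j => `|j - a|%:~R) a =
  2 * p a * \sum_(m < n) vert p m (delta a) a.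
Proof.
rewrite /vert expect_telescope subrr normr0 add0r mulr_sumr.
apply: eq_bigr => m _; rewrite -expectZ; apply: eq_expect => j.
rewrite /avg /delta /=; case: eqP => [->|ja].
  have -> : `|a + 1 - a| = 1 by lia.
  have -> : `|a - 1 - a| = 1 by lia.
  by rewrite subrr normr0 mulr1n mulr0z mulr1z; ring.
have [?|?] : a <= j \/ j < a by lia.
  have -> : `|j + 1 - a| = `|j - a| + 1 by lia.
  have -> : `|j - 1 - a| = `|j - a| - 1 by lia.
  by rewrite !rmorphD !rmorphN rmorph1 /= mulr0n; ring.
have -> : `|j + 1 - a| = `|j - a| - 1 by lia.
have -> : `|j - 1 - a| = `|j - a| + 1 by lia.
by rewrite !rmorphD !rmorphN rmorph1 /= mulr0n; ring.
Qed.

Lemma vert_sqr_le n a b :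
  vert p n (fun j => (j - a)%:~R ^+ 2) b <= (b - a)%:~R ^+ 2 + n%:R.
Proof.
rewrite /vert expect_telescope lerD2l.
apply: le_trans (_ : \sum_(m < n) 1 <= _); last by rewrite sumr_const card_ord.
apply: ler_sum => m _; rewrite -[leRHS](expect_cst p id (+%R^~ 1) (+%R^~ (-1)) m 1 b).
apply: ler_expect => // j; rewrite /avg !rmorphD /= !rmorphN /=.
by have := p_le2 j; nra.
Qed.

Lemma vert_abs_le n a : vert p n (fun j => `|j - a|%:~R) a <= Num.sqrt n%:R.
Proof.
apply: expect_le_sqrt => //.
apply: le_trans (_ : vert p n (fun j => (j - a)%:~R ^+ 2) a <= _); last first.
  by apply: le_trans (vert_sqr_le _ _ _) _; rewrite subrr expr0n add0r.
apply: ler_expect => // j.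
by rewrite intr_norm real_normK ?num_real.
Qed.

Variable omega : R.
Hypothesis omega_gt0 : 0 < omega.
Hypothesis p_ge : forall j, omega <= p j.

Lemma delta_ge0 a j : 0 <= delta a j. Proof. exact: ler0n. Qed.

Lemma vert_delta_ge0 n a b : 0 <= vert p n (delta a) b.
Proof. by apply: expect_ge0 => // j; exact: delta_ge0. Qed.

(** By monotonicity [m] times the return probability at time [2 * m] is at most
    the expected number of visits before that time, which is of order [sqrt m]
    by Tanaka's formula and the trivial second moment bound. *)
Lemma vert_even_diag m a :
  vert p (2 * m) (delta a) a * Num.sqrt m%:R <= omega^-1.
Proof.
case: m => [|m]; first by rewrite sqrtr0 mulr0 invr_ge0 ltW.
set q := vert _ _ _ _; set s := Num.sqrt _.
have s_gt0 : 0 < s by rewrite sqrtr_gt0 ltr0n.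
have ss : s * s = m.+1%:R by rewrite -expr2 sqr_sqrtr // ler0n.
have h1 : m.+1%:R * q <= \sum_(k < (2 * m.+1)) vert p k (delta a) a.
  have mono i : (i <= m.+1)%N -> q <= vert p (2 * i) (delta a) a.
    move=> im; rewrite /q -(subnK im); elim: (_ - _)%N => [//|k IH].
    by apply: le_trans IH; rewrite addSn; exact: vert_even_decr.
  have : forall n, (n <= m.+1)%N ->
      n%:R * q <= \sum_(k < (2 * n)) vert p k (delta a) a.
    elim=> [|n IH] nm; first by rewrite mul0r muln0 big_ord0.
    rewrite (_ : (2 * n.+1 = (2 * n).+2)%N); last by lia.
    rewrite !big_ord_recr /= -natr1 mulrDl mul1r -addrA.
    apply: lerD; first by apply: IH; lia.
    apply: le_trans (mono n _) _; first by lia.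
    by rewrite lerDl vert_delta_ge0.
  by apply.
have h2 : 2 * omega * (m.+1%:R * q) <= Num.sqrt (2 * m.+1)%:R.
  apply: le_trans (vert_abs_le _ a); rewrite vert_abs.
  apply: ler_pM => //.
  - by rewrite mulr_ge0 // ltW.
  - by rewrite mulr_ge0 ?vert_delta_ge0.
  - by rewrite ler_pM2l.
have h3 : Num.sqrt (2 * m.+1)%:R <= 2 * s.
  rewrite natrM sqrtrM // ler_pM2r //.
  by rewrite -[leRHS]ger0_norm // -sqrtr_sqr ler_wsqrtr //; nra.
rewrite -(ler_pM2l omega_gt0) mulfV ?gt_eqF //.
rewrite -(ler_pM2r (x := 2 * s)); last by nra.
rewrite mul1r; apply: le_trans h3; apply: le_trans h2.
by rewrite -ss; lra.
Qed.

(** The uniformity in both points is what allows conditioning on a return to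
    [0]. *)
Lemma vert_even_sup m a b :
  vert p (2 * m) (delta b) a * Num.sqrt m%:R <= (omega ^+ 2)^-1.
Proof.
have ha := vert_even_diag m a; have hb := vert_even_diag m b.
have hab := vert_even_amgm m a b.
set s := Num.sqrt _ in ha hb *.
have s_ge0 : 0 <= s by exact: sqrtr_ge0.
have d c : vert p (2 * m) (delta c) c * s <= omega^-1 ->
    vert p (2 * m) (delta c) c / p c * s <= omega^-1 * omega^-1.
  move=> hc; rewrite mulrAC; apply: ler_pM => //.
  - by rewrite mulr_ge0 // vert_delta_ge0.
  - by rewrite invr_ge0.
  - by rewrite lef_pV2 // posrE.
have {}ha := d _ ha; have {}hb := d _ hb.
have : vert p (2 * m) (delta b) a / p a * s <= omega^-1 * omega^-1.
  apply: le_trans (ler_wpM2r s_ge0 hab) _.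
  by rewrite mulrAC mulrDl; lra.
rewrite expr2 invfM; apply: le_trans.
rewrite mulrAC ler_peMr //; first by rewrite mulr_ge0 ?vert_delta_ge0.
rewrite invf_ge1 //; apply: le_trans (p_le2 a) _; rewrite invf_le1 //; lra.
Qed.

End Vertical.

(** * Correctors and the number of horizontal steps *)

Section Corrector.
Variable R : realType.

Lemma ler_sum_nat n (F : nat -> R) c :
  (forall m, (m < n)%N -> F m <= c) -> \sum_(m < n) F m <= n%:R * c.
Proof.
move=> Fc; apply: le_trans (_ : \sum_(m < n) c <= _); first by apply: ler_sum => m _; exact: Fc.
by rewrite sumr_const card_ord mulr_natl.
Qed.

Definition mean_to_zero (c : nat -> R) := forall eps, 0 < eps ->
  exists n0 : nat, forall n, (n0 <= n)%N -> `|\sum_(1 <= i < n.+1) c i| <= eps * n%:R.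

(** The Poisson equation below is solved separately on the two half-lines, which
    share its right-hand side at [0] equally: hence the term [c 0 / 2]. *)
Definition half_slope (c : nat -> R) (n : nat) : R :=
  c 0%N / 2 + \sum_(1 <= i < n.+1) c i.

Definition half_corr (c : nat -> R) (n : nat) : R :=
  \sum_(m < n) half_slope c m.

Lemma half_corrS c n : half_corr c n.+1 = half_corr c n + half_slope c n.
Proof. by rewrite /half_corr big_ord_recr. Qed.

Lemma half_slopeS c n : half_slope c n.+1 = half_slope c n + c n.+1.
Proof. by rewrite /half_slope big_nat_recr //= addrA. Qed.

Lemma half_slope_sublinear c : mean_to_zero c -> forall eps, 0 < eps ->
  exists2 K, 0 <= K & forall n, `|half_slope c n| <= eps * n%:R + K.
Proof.
move=> c0 eps eps0; have [n0 hn0] := c0 _ eps0.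
exists (`|c 0%N / 2| + \sum_(m < n0) `|half_slope c m|).
  by rewrite addr_ge0 // sumr_ge0.
move=> n; have [n0n|nn0] := leqP n0 n.
  apply: le_trans (ler_normD _ _) _; have := hn0 n n0n.
  have : 0 <= \sum_(m < n0) `|half_slope c m| by apply: sumr_ge0.
  lra.
have : `|half_slope c n| <= \sum_(m < n0) `|half_slope c m|.
  by rewrite (bigD1 (Ordinal nn0)) //= lerDl sumr_ge0.
have : 0 <= eps * n%:R by rewrite mulr_ge0 // ltW.
have : 0 <= `|c 0%N / 2| by [].
lra.
Qed.

Lemma half_corr_subquadratic c : mean_to_zero c -> forall eps, 0 < eps ->
  exists2 K, 0 <= K & forall n, `|half_corr c n| <= eps * n%:R ^+ 2 + K.
Proof.
move=> c0 eps eps0.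
have eps2 : 0 < eps / 2 by lra.
have [K K0 hK] := half_slope_sublinear c0 eps2.
exists (K ^+ 2 / eps); first by rewrite divr_ge0 ?sqr_ge0 // ltW.
move=> n; apply: le_trans (_ : n%:R * (eps / 2 * n%:R + K) <= _).
  rewrite /half_corr; apply: le_trans (ler_norm_sum _ _ _) _.
  apply: (ler_sum_nat (F := fun m => `|half_slope c m|)) => m mn.
  by apply: le_trans (hK m) _; rewrite lerD2r ler_pM2l // ler_nat ltnW.
rewrite -subr_ge0.
have -> : eps * n%:R ^+ 2 + K ^+ 2 / eps - n%:R * (eps / 2 * n%:R + K)
  = ((eps * n%:R - K) ^+ 2 + K ^+ 2) / (2 * eps).
  by field; rewrite gt_eqF.
by rewrite divr_ge0 ?addr_ge0 ?sqr_ge0 //; lra.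
Qed.

(** A solution of the discrete Poisson equation with right-hand side [c]: see
    [corr_laplacian]. *)
Definition corr (c : int -> R) (j : int) : R :=
  match j with
  | Posz n => half_corr (fun i => c i%:Z) n
  | Negz n => half_corr (fun i => c (- i%:Z)) n.+1
  end.

Lemma corr_laplacian c j : corr c (j + 1) + corr c (j - 1) - 2 * corr c j = c j.
Proof.
case: j => [[|n]|n].
- rewrite (_ : 0%:Z + 1 = 1%:Z) // (_ : 0%:Z - 1 = Negz 0) //=.
  by rewrite !half_corrS /half_corr /half_slope !big_ord0 !big_geq // oppr0; lra.
- rewrite (_ : n.+1%:Z + 1 = n.+2%:Z); last by lia.
  rewrite (_ : n.+1%:Z - 1 = n%:Z); last by lia.
  rewrite /= !half_corrS half_slopeS; ring.
- case: n => [|n].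
    rewrite (_ : Negz 0 + 1 = 0%:Z) // (_ : Negz 0 - 1 = Negz 1) //=.
    rewrite !half_corrS half_slopeS /half_corr !big_ord0 NegzE; ring.
  rewrite (_ : Negz n.+1 + 1 = Negz n); last by lia.
  rewrite (_ : Negz n.+1 - 1 = Negz n.+2); last by lia.
  rewrite /= !half_corrS !half_slopeS NegzE; ring.
Qed.

Lemma corr_bounds c :
  mean_to_zero (fun i => c i%:Z) -> mean_to_zero (fun i => c (- i%:Z)) ->
  forall eps, 0 < eps -> exists2 K, 0 <= K & forall j,
    [/\ `|corr c j| <= eps * j%:~R ^+ 2 + K,
        `|corr c (j + 1) - corr c j| <= eps * `|j%:~R| + K
      & `|corr c (j - 1) - corr c j| <= eps * `|j%:~R| + K].
Proof.
move=> cp cn eps eps0.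
have [K1 K10 h1] := half_corr_subquadratic cp eps0.
have [K2 K20 h2] := half_corr_subquadratic cn eps0.
have [K3 K30 h3] := half_slope_sublinear cp eps0.
have [K4 K40 h4] := half_slope_sublinear cn eps0.
exists (K1 + K2 + K3 + K4); first by lra.
have mono (n : nat) : eps * n%:R <= eps * n.+1%:R by rewrite ler_pM2l // ler_nat.
case=> [n|n].
  rewrite -[n%:~R]/(n%:R) normr_nat; split.
  - by have := h1 n; rewrite /=; lra.
  - rewrite (_ : n%:Z + 1 = n.+1%:Z); last by lia.
    by rewrite /= half_corrS addrC addKr; have := h3 n; lra.
  - case: n => [|n].
      rewrite (_ : 0%:Z - 1 = Negz 0) //= half_corrS /half_corr !big_ord0 add0r subr0.
      by have := h4 0%N; lra.
    rewrite (_ : n.+1%:Z - 1 = n%:Z); last by lia.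
    rewrite /= half_corrS distrC addrC addKr.
    by have := h3 n; have := mono n; lra.
have -> : (Negz n)%:~R = - n.+1%:R :> R by rewrite NegzE rmorphN.
rewrite sqrrN normrN normr_nat; split.
- by have := h2 n.+1; rewrite /=; lra.
- case: n => [|n].
    rewrite (_ : Negz 0 + 1 = 0%:Z) //= half_corrS /half_corr !big_ord0 !add0r normrN.
    by have := h4 0%N; have := mono 0%N; lra.
  rewrite (_ : Negz n.+1 + 1 = Negz n); last by lia.
  rewrite /= [half_corr _ n.+2]half_corrS distrC addrC addKr.
  by have := h4 n.+1; have := mono n.+1; lra.
- rewrite (_ : Negz n - 1 = Negz n.+1); last by lia.
  rewrite /= half_corrS addrC addKr.
  by have := h4 n.+1; lra.
Qed.

End Corrector.

Section Counting.
Variables (R : realType) (p : int -> R).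

(** In a state [(h, j)], [h] counts the horizontal steps made so far and [j] is
    the vertical coordinate. *)
Definition cavg := avg (fun x : nat * int => p x.2)
  (fun x => (x.1.+1, x.2)) (fun x => (x.1, x.2 + 1)) (fun x => (x.1, x.2 - 1)).

Definition count := expect (fun x : nat * int => p x.2)
  (fun x => (x.1.+1, x.2)) (fun x => (x.1, x.2 + 1)) (fun x => (x.1, x.2 - 1)).

Lemma count_vert n f x : count n (fun y => f y.2) x = vert p n f x.2.
Proof. exact: expect_map. Qed.

Hypothesis p_gt0 : forall j, 0 < p j.
Hypothesis p_le2 : forall j, p j <= 2^-1.
Let p_ge0 j : 0 <= p j. Proof. exact: ltW. Qed.

Lemma ler_count n f g x : (forall y, f y <= g y) -> count n f x <= count n g x.
Proof. by move=> fg; apply: ler_expect. Qed.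

Lemma ler_count_from n f g (x : nat * int) :
  (forall y : nat * int, (x.1 <= y.1 <= x.1 + n)%N -> f y <= g y) ->
  count n f x <= count n g x.
Proof.
move=> fg.
apply: (@ler_expect_inv _ _ _ _ _ _ _ _
  (fun m (y : nat * int) => (x.1 <= y.1 <= x.1 + m)%N) _ 0%N) => //.
- by move=> m y /= hy; split; lia.
- by rewrite addn0 leqnn.
Qed.

(** The parity constraint holds because each vertical step changes the parity of
    [j]; it excludes odd numbers of horizontal steps on a return to [0] at an
    even time. *)
Lemma ler_count_reach n f g :
  (forall (h : nat) (j : int), (h <= n)%N -> ~~ odd (n + h + absz j) -> f (h, j) <= g (h, j)) ->
  count n f (0%N, 0) <= count n g (0%N, 0).
Proof.
move=> fg.
apply: (@ler_expect_inv _ _ _ _ _ _ _ _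
  (fun m (y : nat * int) => (y.1 <= m)%N && ~~ odd (m + y.1 + absz y.2)) _ 0%N) => //.
- by move=> m y /= /andP[ym yo]; split; apply/andP; split; lia.
- by move=> [h j] /=; rewrite add0n => /andP[]; exact: fg.
Qed.

Variable gamma : R.
Hypothesis gamma_gt1 : 1 < gamma.
Hypothesis mean_pos : mean_to_zero (fun i => (p i%:Z)^-1 - 2 * gamma).
Hypothesis mean_neg : mean_to_zero (fun i => (p (- i%:Z))^-1 - 2 * gamma).

Let phi := corr (fun j => (p j)^-1 - 2 * gamma).

Let phi0 : phi 0 = 0. Proof. exact: big_ord0. Qed.

Let phi_lapl j : phi (j + 1) + phi (j - 1) - 2 * phi j = (p j)^-1 - 2 * gamma.
Proof. exact: corr_laplacian. Qed.

Let phi_bounds eps : 0 < eps -> exists2 K, 0 <= K & forall j,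
    [/\ `|phi j| <= eps * j%:~R ^+ 2 + K,
        `|phi (j + 1) - phi j| <= eps * `|j%:~R| + K
      & `|phi (j - 1) - phi j| <= eps * `|j%:~R| + K].
Proof. by move=> /corr_bounds; apply. Qed.

(** The law of large numbers for the number of horizontal steps.  With [phi] the
    corrector, [h - (1 - 1 / gamma) * m - phi j / gamma] is a martingale.  As the
    slope of [phi] is sublinear and the second moment of the vertical coordinate
    is at most the time, both the martingale and [phi] are [o(n)] in mean. *)
Lemma count_mean eps : 0 < eps -> exists n0 : nat, forall n, (n0 <= n)%N ->
  count n (fun x => `|x.1%:R - (1 - gamma^-1) * n%:R|) (0%N, 0) <= eps * n%:R.
Proof.
move=> eps0.
have eps4 : 0 < eps / 4 by lra.
have [K K0 hK] := phi_bounds eps4.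
pose a := 1 + 2 * (1 + K) ^+ 2.
have a0 : 0 < a by rewrite /a; nra.
exists (Num.truncn (8 * a / eps ^+ 2 + 4 * K / eps)).+1 => n nn0.
have {nn0} nbig : 8 * a / eps ^+ 2 + 4 * K / eps <= n%:R.
  by apply/ltW; rewrite -truncn_lt_nat //; apply: addr_ge0; apply: divr_ge0; nra.
have t1 : 0 <= 8 * a / eps ^+ 2 by apply: divr_ge0; nra.
have t2 : 0 <= 4 * K / eps by apply: divr_ge0; nra.
have n1 : 8 * a <= eps ^+ 2 * n%:R.
  by rewrite [leRHS]mulrC -ler_pdivrMr ?exprn_gt0 //; lra.
have n2 : 4 * K <= eps * n%:R by rewrite [leRHS]mulrC -ler_pdivrMr //; lra.
pose gi := gamma^-1.
have gi0 : 0 < gi by rewrite invr_gt0 (lt_trans ltr01).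
have g0 : 0 < gamma by exact: lt_trans ltr01 _.
have gi1 : gi < 1 by rewrite invf_lt1.
have gg : gamma * gi = 1 by rewrite mulfV ?gt_eqF.
pose Y (m : nat) (x : nat * int) := x.1%:R - (1 - gi) * m%:R - phi x.2 * gi.
have Ysq : count n (fun x => Y n x ^+ 2) (0%N, 0) <= (eps / 2 * n%:R) ^+ 2.
  apply: le_trans (@expect_drift _ _ _ _ _ _ _ _ (fun _ _ => True) _ (fun m x => Y m x ^+ 2)
     (fun m x => a + eps ^+ 2 / 8 * x.2%:~R ^+ 2) n (0%N, 0) _ _) _ => //.
    move=> m [h j] _ _; rewrite /avg /Y /=.
    have [_ h1 h2] := hK j.
    have := phi_lapl j.
    set d1 := phi (j + 1) - phi j in h1 *; set d2 := phi (j - 1) - phi j in h2 *.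
    rewrite (_ : phi (j + 1) = d1 + phi j); last by rewrite /d1; ring.
    rewrite (_ : phi (j - 1) = d2 + phi j); last by rewrite /d2; ring.
    move=> lap.
    have {}lap : p j * (d1 + d2) = 1 - 2 * gamma * p j.
      rewrite (_ : d1 + d2 = (p j)^-1 - 2 * gamma); last by rewrite -lap; ring.
      by field; rewrite gt_eqF.
    have lapg : p j * gi * (d1 + d2) = gi - 2 * p j.
      rewrite mulrAC lap (_ : _ * gi = gi - 2 * p j * (gamma * gi)); last by ring.
      by rewrite gg mulr1.
    set y := h%:R - (1 - gi) * m%:R - phi j * gi.
    have -> : h.+1%:R - (1 - gi) * m.+1%:R - phi j * gi = y + gi.
      by rewrite /y -!natr1; ring.
    have -> : h%:R - (1 - gi) * m.+1%:R - (d1 + phi j) * gi = y - (1 - gi + d1 * gi).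
      by rewrite /y -!natr1; ring.
    have -> : h%:R - (1 - gi) * m.+1%:R - (d2 + phi j) * gi = y - (1 - gi + d2 * gi).
      by rewrite /y -!natr1; ring.
    have bd d : `|d| <= eps / 4 * `|j%:~R| + K ->
        (1 - gi + d * gi) ^+ 2 <= 2 * (1 + K) ^+ 2 + eps ^+ 2 / 8 * j%:~R ^+ 2.
      move=> hd.
      have h0 : `|1 - gi + d * gi| <= eps / 4 * `|j%:~R| + K + 1.
        apply: le_trans (ler_normD _ _) _; rewrite addrC; apply: lerD.
          rewrite normrM [`|gi|]gtr0_norm //; apply: le_trans hd.
          by rewrite ler_piMr // ltW.
        by rewrite ger0_norm; lra.
      rewrite -[_ ^+ 2]real_normK ?num_real //.
      apply: le_trans (_ : (eps / 4 * `|j%:~R| + (K + 1)) ^+ 2 <= _).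
        by rewrite addrA ler_sqr ?nnegrE //; apply: le_trans h0.
      rewrite -[j%:~R ^+ 2]real_normK ?num_real //.
      have := sqr_ge0 (eps / 4 * `|j%:~R| - (K + 1)); nra.
    have {}h1 := bd _ h1; have {}h2 := bd _ h2.
    have pj := p_gt0 j; have pj2 := p_le2 j.
    have -> : (1 - 2 * p j) * (y + gi) ^+ 2 + p j *
        ((y - (1 - gi + d1 * gi)) ^+ 2 + (y - (1 - gi + d2 * gi)) ^+ 2)
      = y ^+ 2 + 2 * y * ((1 - 2 * p j) * gi - 2 * p j * (1 - gi) - p j * gi * (d1 + d2))
        + ((1 - 2 * p j) * gi ^+ 2 +
           p j * ((1 - gi + d1 * gi) ^+ 2 + (1 - gi + d2 * gi) ^+ 2)) by ring.
    rewrite lapg.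
    rewrite (_ : (1 - 2 * p j) * gi - 2 * p j * (1 - gi) - (gi - 2 * p j) = 0); last by ring.
    rewrite mulr0 addr0 lerD2l /a -[leRHS]addrA; apply: lerD.
      by rewrite -[leRHS]mulr1; apply: ler_pM; nra.
    apply: le_trans (_ : 2^-1 * _ <= _).
      by apply: ler_wpM2r pj2; rewrite addr_ge0 ?sqr_ge0.
    lra.
  have Y0 : Y 0%N (0%N, 0) = 0 by rewrite /Y mulr0 subr0 [phi _]phi0 mul0r subr0.
  rewrite [X in X ^+ 2 + _]Y0 expr0n add0r.
  apply: le_trans (_ : \sum_(m < n) (a + eps ^+ 2 / 8 * n%:R) <= _).
    apply: ler_sum => m _.
    rewrite expectD expectZ expect_cst lerD2l ler_pM2l ?divr_gt0 ?exprn_gt0 //.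
    rewrite -/(count m (fun x => x.2%:~R ^+ 2) (0%N, 0)).
    rewrite (count_vert m (fun j => j%:~R ^+ 2)) /=.
    rewrite (_ : (fun j : int => j%:~R ^+ 2) = (fun j => (j - 0)%:~R ^+ 2 : R)); last first.
      by apply/funext => j; rewrite subr0.
    apply: le_trans (vert_sqr_le _ _ _ _ _) _ => //.
    by rewrite subrr expr0n add0r ler_nat ltnW.
  rewrite sumr_const card_ord -mulr_natl.
  have := ler0n R n; nra.
have Y1 : count n (fun x => `|Y n x|) (0%N, 0) <= eps / 2 * n%:R.
  rewrite -[leRHS]ger0_norm; last by rewrite mulr_ge0 //; lra.
  rewrite -sqrtr_sqr; apply: expect_le_sqrt => //.
  apply: le_trans Ysq; apply: ler_expect => // x.
  by rewrite real_normK ?num_real.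
have P1 : count n (fun x => `|phi x.2|) (0%N, 0) <= eps / 4 * n%:R + K.
  apply: le_trans (_ : count n (fun x => eps / 4 * (x.2%:~R ^+ 2) + K) (0%N, 0) <= _).
    by apply: ler_count => x; have [] := hK x.2.
  rewrite /count expectD expectZ expect_cst lerD2r ler_pM2l //.
  rewrite -/(count n (fun x => x.2%:~R ^+ 2) (0%N, 0)).
  rewrite (count_vert n (fun j => j%:~R ^+ 2)) /=.
  rewrite (_ : (fun j : int => j%:~R ^+ 2) = (fun j => (j - 0)%:~R ^+ 2 : R)); last first.
    by apply/funext => j; rewrite subr0.
  apply: le_trans (vert_sqr_le _ _ _ _ _) _ => //.
  by rewrite subrr expr0n add0r.
apply: le_trans (_ : count n (fun x => `|Y n x| + `|phi x.2|) (0%N, 0) <= _).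
  apply: ler_count => x.
  have -> : x.1%:R - (1 - gamma^-1) * n%:R = Y n x + phi x.2 * gi.
    by rewrite /Y /gi; ring.
  apply: le_trans (ler_normD _ _) _; rewrite lerD2l normrM [`|gi|]gtr0_norm //.
  by rewrite ler_piMr // ltW.
rewrite /count expectD -!/(count _ _ _).
have := Y1; have := P1; lra.
Qed.

(** The function [psi = 2 / (gamma - 1) * phi + j ^+ 2] is bounded below since
    [phi] is subquadratic, and its second difference is
    [B * (1 / p j - 2) - 1 / p j] with [B = (gamma + 1) / (gamma - 1)].  Therefore
    [- B * (g 0 + ... + g (h - 1)) + g h * (psi j + L)] decreases in mean by at
    least [g h] at each step, and the expectations of [g h] over the first [N]
    steps, which are nonincreasing, have a sum bounded independently of [N]. *)
Lemma count_small_horizontal : exists2 K : R, 0 < K &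
  forall (g : nat -> R) (S : R) (N : nat),
    (forall i, 0 <= g i) -> (forall i, g i.+1 <= g i) ->
    (forall h : nat, \sum_(i < h) g i <= S) ->
    N%:R * count N (fun x => g x.1) (0%N, 0) <= K * (g 0%N + S).
Proof.
pose B := (gamma + 1) / (gamma - 1).
have B1 : B = 1 + 2 / (gamma - 1) by rewrite /B; field; rewrite subr_eq0 gt_eqF.
have e0 : 0 < (gamma - 1) / 2 by rewrite divr_gt0 ?subr_gt0.
have B2 : 0 < 2 / (gamma - 1) by rewrite divr_gt0 // subr_gt0.
have [K K0 hK] := phi_bounds e0.
pose L := 2 / (gamma - 1) * K.
have L0 : 0 <= L by rewrite /L mulr_ge0 // ltW.
pose psi (j : int) : R := 2 / (gamma - 1) * phi j + j%:~R ^+ 2.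
have psi_ge j : - L <= psi j.
  have [h _ _] := hK j; rewrite /psi /L.
  have : - (2 / (gamma - 1)) * ((gamma - 1) / 2 * j%:~R ^+ 2 + K) <= 2 / (gamma - 1) * phi j.
    rewrite mulNr -mulrN ler_pM2l // lerNl; apply: le_trans h.
    by rewrite -normrN ler_norm.
  have -> : - (2 / (gamma - 1)) * ((gamma - 1) / 2 * j%:~R ^+ 2 + K) =
     - (j%:~R ^+ 2) - 2 / (gamma - 1) * K :> R.
    by field; rewrite subr_eq0 gt_eqF.
  lra.
have psi_lapl j : p j * (psi (j + 1) + psi (j - 1) - 2 * psi j) = B * (1 - 2 * p j) - 1.
  rewrite (_ : psi (j + 1) + psi (j - 1) - 2 * psi j =
    2 / (gamma - 1) * (phi (j + 1) + phi (j - 1) - 2 * phi j) + 2); last first.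
    by rewrite /psi rmorphB rmorphD /= rmorph1; ring.
  rewrite phi_lapl B1; field.
  by rewrite subr_eq0 !gt_eqF.
exists (B + L); first by rewrite B1; have := B2; have := L0; lra.
move=> g S N g0 gdec gS.
have S0 : 0 <= S by have := gS 0%N; rewrite big_ord0.
pose G (h : nat) := \sum_(i < h) g i.
pose Phi (x : nat * int) := - B * G x.1 + g x.1 * (psi x.2 + L).
have drift : count N Phi (0%N, 0) <= Phi (0%N, 0) +
    \sum_(m < N) count m (fun x => - g x.1) (0%N, 0).
  apply: (@expect_drift _ _ _ _ _ _ _ _ (fun _ _ => True) _ (fun _ => Phi)
     (fun m x => - g x.1) N) => //.
  move=> m [h j] _ _; rewrite /avg /Phi /= /G big_ord_recr /=.
  have pj := p_gt0 j; have pj2 := p_le2 j.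
  have := psi_lapl j; have := psi_ge j; have := gdec h; have := g0 h.
  set Sg := \sum_(i < h) g i; set q := p j in pj pj2 *.
  set w := psi j; set w1 := psi (j + 1); set w2 := psi (j - 1).
  move=> gh0 gh psig lap.
  rewrite -subr_ge0.
  have -> : - B * Sg + g h * (w + L) + - g h - ((1 - 2 * q) * (- B * (Sg + g h) + g h.+1 * (w + L))
    + q * (- B * Sg + g h * (w1 + L) + (- B * Sg + g h * (w2 + L)))) =
    (1 - 2 * q) * (g h - g h.+1) * (w + L) + g h * (B * (1 - 2 * q) - 1 - q * (w1 + w2 - 2 * w)).
    by ring.
  by rewrite lap subrr mulr0 addr0 mulr_ge0 ?mulr_ge0 //; lra.
have mono m : (m <= N)%N ->
    count N (fun x => g x.1) (0%N, 0) <= count m (fun x => g x.1) (0%N, 0).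
  move=> mN; rewrite -(subnK mN); elim: (_ - _)%N => [//|k IH].
  apply: le_trans IH; rewrite addSn /count expectSr; apply: ler_expect => // x.
  rewrite /avg /=; have := gdec x.1; have := p_gt0 x.2; have := p_le2 x.2; nra.
have PhiN : - B * S <= count N Phi (0%N, 0).
  rewrite -[leLHS](@expect_cst _ _ (fun x : nat * int => p x.2)
    (fun x => (x.1.+1, x.2)) (fun x => (x.1, x.2 + 1)) (fun x => (x.1, x.2 - 1)) N _ (0%N, 0)).
  apply: ler_count => x; rewrite /Phi.
  have h1 : 0 <= g x.1 * (psi x.2 + L).
    by apply: mulr_ge0 => //; have := psi_ge x.2; lra.
  have h2 : B * G x.1 <= B * S by apply: ler_wpM2l (gS _); rewrite B1; have := B2; lra.
  lra.
have sumle : N%:R * count N (fun x => g x.1) (0%N, 0) <=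
    - \sum_(m < N) count m (fun x => - g x.1) (0%N, 0).
  rewrite lerNr -mulrN; apply: (ler_sum_nat (F := fun m => count m (fun x => - g x.1) (0%N, 0))).
  move=> m mN; rewrite lerNr; apply: le_trans (mono m (ltnW mN)) _.
  rewrite -[leRHS]mulN1r /count -expectZ; apply: ler_expect => // x.
  by rewrite mulN1r opprK.
have : Phi (0%N, 0) = g 0%N * L.
  rewrite /Phi /psi [G _]big_ord0 [phi _]phi0 expr0n.
  by rewrite !mulr0 !add0r.
have := g0 0%N.
have : 0 <= B by rewrite B1; have := B2; lra.
nra.
Qed.

End Counting.

(** * The simple random walk and Wallis' product *)

Section SimpleWalk.
Variable R : realType.

Definition srw := vert (fun=> 2^-1 : R).

Definition ret (n : nat) : R := srw n (delta R 0) 0.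

Definition mean_abs (n : nat) (j : int) : R := srw n (fun i => `|i|%:~R) j.

Let half_gt0 (j : int) : 0 < 2^-1 :> R. Proof. by rewrite invr_gt0. Qed.
Let half_le (j : int) : 2^-1 <= 2^-1 :> R. Proof. by []. Qed.

Lemma srwS n f j : srw n.+1 f j = (srw n f (j + 1) + srw n f (j - 1)) / 2.
Proof. by rewrite /srw /vert expectS /avg; field. Qed.

Lemma ret_ge0 n : 0 <= ret n.
Proof. by apply: vert_delta_ge0. Qed.

Lemma srw_binomial n i :
  srw n (delta R 0) (n%:Z - 2 * i%:Z) = 'C(n, i)%:R / 2 ^+ n.
Proof.
elim: n i => [|n IH] i.
  rewrite /srw /vert /expect /= /delta expr0 divr1.
  case: i => [|i]; first by rewrite bin0 mulr0 subrr eqxx.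
  by rewrite bin_small // (_ : (_ == _) = false) //; apply/negP => /eqP; lia.
rewrite srwS (_ : _ - 1 = n%:Z - 2 * i%:Z); last by lia.
rewrite IH; case: i => [|i].
  rewrite /srw vert_support ?add0r; last by lia.
  by rewrite !bin0 exprS; field.
rewrite (_ : _ + 1 = n%:Z - 2 * i%:Z); last by lia.
by rewrite IH binS natrD exprS; field.
Qed.

Lemma ret_even m : ret (2 * m) = 'C(2 * m, m)%:R / 2 ^+ (2 * m).
Proof. by rewrite -srw_binomial; congr (srw _ _ _); lia. Qed.

Lemma ret_odd m : ret (2 * m).+1 = 0.
Proof.
suff H n (j : int) : odd (n + absz j) -> srw n (delta R 0) j = 0 by apply: H; lia.
elim: n j => [|n IH] j hj.
  by rewrite /srw /vert /expect /= /delta; case: eqP => // j0; move: hj; rewrite j0.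
rewrite srwS !IH; [by rewrite addr0 mul0r | lia | lia].
Qed.

Lemma ret_rec m : (2 * m.+1)%:R * ret (2 * m.+1) = (2 * m).+1%:R * ret (2 * m).
Proof.
rewrite !ret_even (_ : (2 * m.+1 = (2 * m).+2)%N); last by lia.
rewrite !exprS.
have e1 := mul_bin_diag (2 * m).+2 m; have e2 := mul_bin_down (2 * m).+1 m.
have e : ((2 * m).+2 * 'C((2 * m).+2, m.+1) = 4 * ((2 * m).+1 * 'C(2 * m, m)))%N.
  rewrite /= in e1 e2.
  have e3 : ((2 * m).+1 - m = m.+1)%N by lia.
  rewrite e3 in e2; move: e1 e2.
  move: 'C((2 * m).+2, m.+1) 'C((2 * m).+1, m) 'C(2 * m, m) => c2 c1 c0; nia.
have {}e := congr1 (fun k => k%:R : R) e; rewrite !natrM in e.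
rewrite !mulrA.
rewrite [in LHS]e; field.
exact: expf_neq0.
Qed.

Lemma ret_gt0 m : 0 < ret (2 * m).
Proof. by rewrite ret_even divr_gt0 ?exprn_gt0 // ltr0n bin_gt0; lia. Qed.

Lemma ret_sum m : \sum_(k < 2 * m) ret k = (2 * m)%:R * ret (2 * m).
Proof.
elim: m => [|m IH]; first by rewrite muln0 big_ord0 mul0r.
rewrite ret_rec (_ : (2 * m.+1 = (2 * m).+2)%N); last by lia.
rewrite !big_ord_recr /= IH ret_odd addr0 -natr1; ring.
Qed.

(** The primitive of [cos ^+ n] that vanishes at [0], given by the recursion of
    integration by parts; its values at [pi / 2] are Wallis' integrals. *)
Fixpoint cos_prim (n : nat) (x : R) : R :=
  match n with
  | 0 => x
  | S m => match m with
    | 0 => sin x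
    | S k => (cos x ^+ m * sin x + m%:R * cos_prim k x) / m.+1%:R
    end
  end.

Lemma cos_prim_derive n (x : R) : is_derive x 1 (cos_prim n) (cos x ^+ n).
Proof.
have [m] := ubnP n; elim: m n => // m IH [|[|n]] nm.
- by rewrite expr0; exact: is_derive_id.
- by rewrite expr1; exact: is_derive_sin.
- have h := IH n ltac:(lia).
  rewrite (_ : cos_prim n.+2 = (n.+2%:R)^-1 \*:
     ((cos ^+ n.+1) * sin + n.+1%:R \*: cos_prim n)); last first.
    apply/funext => y; rewrite /= !fctE /= [LHS]mulrC.
    by rewrite /GRing.scale /=.
  apply: is_derive_eq.
  rewrite /GRing.scale /= !fctE /=.
  have cs := cos2Dsin2 x.
  have -> : sin x * (n.+1%:R * cos x ^+ n * - sin x) =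
    - n.+1%:R * cos x ^+ n * (sin x ^+ 2) by ring.
  have -> : sin x ^+ 2 = 1 - cos x ^+ 2 by rewrite -cs; ring.
  have n0 : n%:R + 1 + 1 != 0 :> R by rewrite !natr1 pnatr_eq0.
  by rewrite -[n.+2%:R]natr1 -[n.+1%:R]natr1 !exprS expr0; field.
Qed.

Lemma cos_prim0 n : cos_prim n 0 = 0.
Proof.
have [m] := ubnP n; elim: m n => // m IH [|[|n]] nm //.
- exact: sin0.
- by rewrite /= sin0 mulr0 IH ?mulr0 ?addr0 ?mul0r //; lia.
Qed.

Lemma cos_prim_rec n :
  n.+2%:R * cos_prim n.+2 (pi / 2) = n.+1%:R * cos_prim n (pi / 2).
Proof.
rewrite /= cos_pihalf exprS !mul0r add0r mulrC mulfVK //; by rewrite pnatr_eq0.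
Qed.

Lemma cos_prim_even m : cos_prim (2 * m) (pi / 2) = pi / 2 * ret (2 * m).
Proof.
elim: m => [|m IH].
  by rewrite muln0 /ret /srw /vert /expect /= /delta eqxx mulr1.
have n0 : (2 * m.+1)%:R != 0 :> R by rewrite pnatr_eq0.
apply: (mulfI n0); rewrite mulrCA ret_rec.
have := cos_prim_rec (2 * m).
rewrite (_ : (2 * m).+2 = (2 * m.+1)%N); last by lia.
move=> ->; rewrite IH; ring.
Qed.

Lemma cos_prim_odd m :
  (2 * m).+1%:R * ret (2 * m) * cos_prim (2 * m).+1 (pi / 2) = 1.
Proof.
elim: m => [|m IH].
  by rewrite muln0 /ret /srw /vert /expect /= /delta eqxx sin_pihalf !mulr1.
have := cos_prim_rec (2 * m).+1.
rewrite (_ : (2 * m).+3 = (2 * m.+1).+1%N); last by lia.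
rewrite (_ : (2 * m).+2 = (2 * m.+1)%N); last by lia.
rewrite [X in X = 1]mulrAC => ->.
by rewrite mulrAC ret_rec.
Qed.

Lemma cos_prim_decr n : cos_prim n.+1 (pi / 2) <= cos_prim n (pi / 2).
Proof.
rewrite -subr_ge0.
pose f (x : R) := cos_prim n x - cos_prim n.+1 x.
have df (x : R) : is_derive x 1 f (cos x ^+ n - cos x ^+ n.+1).
  by apply: is_deriveB; exact: cos_prim_derive.
have -> : 0 = f 0 by rewrite /f !cos_prim0 subrr.
have p2 : 0 <= pi / 2 :> R by have := @pi_gt0 R; lra.
apply: (@ger0_derive1_le_cc R f 0 (pi / 2)) => //; rewrite ?in_itv /= ?lexx ?p2 //.
- move=> x; rewrite in_itv /= => /andP[x0 x1].
  rewrite derive1E derive_val exprS -{1}[_ ^+ n]mul1r -mulrBl mulr_ge0 //.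
  rewrite exprn_ge0 // ltW // cos_gt0_pihalf // x1 (lt_trans _ x0) // oppr_lt0; lra.
- apply: continuous_subspaceT => x; apply: differentiable_continuous.
  by apply/derivable1_diffP.
Qed.

(** Wallis' integrals decrease, and those of even and odd index are [ret] and its
    inverse up to explicit factors; comparing neighbours encloses [ret ^+ 2]. *)
Lemma ret_lower m : 2 <= pi * (2 * m).+1%:R * ret (2 * m) ^+ 2.
Proof.
have := cos_prim_decr (2 * m); rewrite cos_prim_even => h.
have r0 := ret_gt0 m.
have c0 : 0 < (2 * m).+1%:R * ret (2 * m) by rewrite mulr_gt0.
move: h; rewrite -(ler_pM2l c0) cos_prim_odd.
by rewrite expr2; lra.
Qed.

Lemma ret_upper m : pi * m%:R * ret (2 * m) ^+ 2 <= 1.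
Proof.
case: m => [|m]; first by rewrite mulr0 mul0r.
have := cos_prim_decr (2 * m).+1.
rewrite (_ : (2 * m).+2 = (2 * m.+1)%N); last by lia.
rewrite cos_prim_even => h.
have r0 := ret_gt0 m.
have c0 : 0 < (2 * m).+1%:R * ret (2 * m) by rewrite mulr_gt0.
move: h; rewrite -(ler_pM2l c0) cos_prim_odd.
rewrite -ret_rec natrM expr2; lra.
Qed.

Lemma mean_absS n j : mean_abs n.+1 j = (mean_abs n (j + 1) + mean_abs n (j - 1)) / 2.
Proof. exact: srwS. Qed.

(** Tanaka's formula for the simple walk, with the partial sums of the return
    probabilities in closed form. *)
Lemma mean_abs_zero m : mean_abs (2 * m) 0 = (2 * m)%:R * ret (2 * m).
Proof.
rewrite -ret_sum; have := vert_abs (fun=> 2^-1 : R) (2 * m) 0.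
rewrite mulfV // mul1r => <-; congr (srw _ _ _).
by apply/funext => j; rewrite subr0.
Qed.

Lemma mean_abs_succ n j : mean_abs n.+1 j = mean_abs n j + srw n (delta R 0) j.
Proof.
rewrite /mean_abs /srw /vert expectSr -expectD; apply: eq_expect => i.
rewrite /avg /delta; case: eqP => [->|i0].
  by rewrite add0r sub0r normrN normr1 normr0 mulr1z mulr0z mulr1n; field.
have [?|?] : 0 <= i \/ i < 0 by lia.
  have -> : `|i + 1| = `|i| + 1 by lia.
  have -> : `|i - 1| = `|i| - 1 by lia.
  by rewrite !rmorphD !rmorphN rmorph1 /= mulr0n; field.
have -> : `|i + 1| = `|i| - 1 by lia.
have -> : `|i - 1| = `|i| + 1 by lia.
by rewrite !rmorphD !rmorphN rmorph1 /= mulr0n; field.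
Qed.

Lemma srw_even_sup l j : srw (2 * l) (delta R 0) j * Num.sqrt l%:R <= 4.
Proof.
have := @vert_even_sup R (fun=> 2^-1) half_gt0 half_le 2^-1 (half_gt0 0) half_le l j 0.
by rewrite -exprVn invrK -natrX.
Qed.

Lemma mean_abs_ge n j : `|j|%:~R <= mean_abs n j.
Proof.
elim: n => [//|n IH]; rewrite mean_abs_succ.
by apply: le_trans IH _; rewrite lerDl; apply: vert_delta_ge0.
Qed.

Lemma mean_abs_le n j : mean_abs n j <= `|j|%:~R + Num.sqrt n%:R.
Proof.
apply: le_trans (_ : Num.sqrt (j%:~R ^+ 2 + n%:R) <= _).
  apply: expect_le_sqrt => //.
  apply: le_trans (_ : srw n (fun i => (i - 0)%:~R ^+ 2) j <= _).
    by apply: ler_expect => // i; rewrite subr0 intr_norm real_normK ?num_real.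
  by apply: le_trans (vert_sqr_le _ _ _ _ _) _ => //; rewrite subr0.
have j0 : 0 <= `|j|%:~R :> R by rewrite ler0z.
rewrite -[leRHS]ger0_norm ?addr_ge0 // -sqrtr_sqr ler_wsqrtr //.
rewrite sqrrD sqr_sqrtr // intr_norm real_normK ?num_real // lerD2r lerDl.
by rewrite mulrn_wge0 // mulr_ge0.
Qed.

Lemma mean_abs_add_le n l : mean_abs (n + l) 0 <= mean_abs n 0 + Num.sqrt l%:R.
Proof.
rewrite /mean_abs /srw /vert expect_add.
rewrite -[Num.sqrt _](@expect_cst _ _ (fun=> 2^-1 : R) id (fun j : int => j + 1)
  (fun j => j - 1) n _ 0) -expectD.
by apply: ler_expect => // j; exact: mean_abs_le.
Qed.

Lemma mean_abs_mono m n : (m <= n)%N -> mean_abs m 0 <= mean_abs n 0.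
Proof.
move=> /subnK <-; elim: (_ - _)%N => [//|k IH].
by rewrite addSn mean_abs_succ; apply: le_trans IH _; rewrite lerDl; apply: vert_delta_ge0.
Qed.

End SimpleWalk.

(** * From the Markov chain to averaging operators *)

Section Probability.
Context (d : measure_display) (T : measurableType d) (R : realType).
Variable P : probability T R.

Lemma Pr_ge0 A : 0 <= Pr P A.
Proof. by rewrite /Pr fine_ge0. Qed.

Lemma Pr_setU A B : measurable A -> measurable B -> A `&` B = set0 ->
  Pr P (A `|` B) = Pr P A + Pr P B.
Proof.
move=> mA mB AB; rewrite /Pr measureU // fineD //; exact: fin_num_measure.
Qed.

Lemma Pr_split A B : measurable A -> measurable B ->
  Pr P A = Pr P (A `&` B) + Pr P (A `&` ~` B).
Proof.
move=> mA mB; rewrite -Pr_setU.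
- by rewrite -setIUr setUv setIT.
- exact: measurableI.
- by apply: measurableI => //; exact: measurableC.
- by rewrite setIACA setICr setI0.
Qed.

Lemma Pr_subset A B : measurable A -> measurable B -> A `<=` B -> Pr P A <= Pr P B.
Proof.
move=> mA mB AB; rewrite (Pr_split mB mA) (setIidr AB) lerDl.
exact: Pr_ge0.
Qed.

Variable S : countType.

Lemma measurable_preimage (X : T -> S) (Y : set S) :
  (forall s, measurable (X @^-1` [set s])) -> measurable (X @^-1` Y).
Proof.
move=> mX; pose F k := if unpickle k is Some y then X @^-1` [set y] else set0.
rewrite (_ : X @^-1` Y = \bigcup_(k in [set pickle y | y in Y]) F k).
  by apply: bigcup_measurable => _ [y _ <-]; rewrite /F pickleK.
apply/seteqP; split => [t Yt|t [_ [y Yy <-]]]; last by rewrite /F pickleK => /= ->.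
by exists (pickle (X t)); [exists (X t)|rewrite /F pickleK].
Qed.

Lemma Pr_partition (X : T -> S) (A : set T) (s : seq S) :
  (forall y, measurable (X @^-1` [set y])) -> measurable A -> uniq s ->
  Pr P A = \sum_(y <- s) Pr P (A `&` X @^-1` [set y])
           + Pr P (A `&` X @^-1` [set y | y \notin s]).
Proof.
move=> mX mA; elim: s => [_|y s IH] /=.
  rewrite big_nil add0r; congr Pr; apply/seteqP; split => [t At|t []] //=.
move=> /andP[ys us]; rewrite (IH us) big_cons.
rewrite [X in _ + X = _](@Pr_split _ (X @^-1` [set y])) //; last first.
  by apply: measurableI => //; exact: measurable_preimage.
rewrite addrCA addrA; congr (_ + _ + _); congr Pr.
  apply/seteqP; split => [t /= [[At _] Xt]|t /= [At Xt]]; split => //.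
  by split => //; rewrite Xt.
apply/seteqP; split => t /=.
  by move=> [[At ns] /eqP ny]; split => //; rewrite inE negb_or ny.
by rewrite inE negb_or => -[At /andP[/eqP ny ns]].
Qed.

(** The conditioning events of the Markov property. *)
Definition past (X : nat -> T -> S) (N : nat) (x : nat -> S) : set T :=
  [set t | forall n, (n <= N)%N -> X n t = x n].

Variables (Q : S -> S -> R) (s0 : S) (X : nat -> T -> S).
Hypothesis chainX : is_markov_chain P Q s0 X.
(** Each state has finitely many successors, so that transition sums are finite. *)
Variable nbr : S -> seq S.
Hypothesis nbr_uniq : forall a, uniq (nbr a).
Hypothesis nbr_sum : forall a, \sum_(y <- nbr a) Q a y = 1.

Let mX n s : measurable (X n @^-1` [set s]).
Proof. by have [h _ _] := chainX. Qed.

Lemma measurable_past N x : measurable (past X N x).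
Proof.
elim: N => [|N IH].
  rewrite (_ : past X 0 x = X 0%N @^-1` [set x 0%N]) //.
  by apply/seteqP; split => [t h|t h [|n]] //; exact: h.
rewrite (_ : past X N.+1 x = past X N x `&` X N.+1 @^-1` [set x N.+1]).
  exact: measurableI.
apply/seteqP; split => [t h|t [h1 h2] n].
  by split; [move=> n nN; apply: h; lia|exact: h].
rewrite leq_eqVlt => /orP[/eqP ->//|]; rewrite ltnS; exact: h1.
Qed.

Lemma Pr_past_step N x y :
  Pr P (past X N x `&` X N.+1 @^-1` [set y]) = Pr P (past X N x) * Q (x N) y.
Proof.
have [_ _ h] := chainX.
have := Pr_ge0 (past X N x); rewrite le_eqVlt => /orP[/eqP past0|past0].
  rewrite -past0 mul0r; apply/eqP; rewrite eq_le Pr_ge0 andbT past0.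
  apply: Pr_subset; [|exact: measurable_past|exact: subIsetl].
  by apply: measurableI => //; exact: measurable_past.
have := h N x y past0; rewrite /condPr setIC => <-.
by rewrite mulrC divfK // gt_eqF.
Qed.

Definition transition (f : S -> R) (a : S) : R := \sum_(y <- nbr a) Q a y * f y.

(** The Markov property at one step extends to [n] steps by induction on [n] for
    all pasts at once: the first new step extends the past by one state. *)
Lemma Pr_past_future (Y : set S) n N x :
  Pr P (past X N x `&` X (N + n)%N @^-1` Y) =
  Pr P (past X N x) * iter n transition (fun s => (s \in Y)%:R) (x N).
Proof.
have mE m : measurable (X m @^-1` Y) by exact: measurable_preimage.
elim: n N x => [|n IH] N x.
  rewrite addn0 /=; case: (asboolP (Y (x N))) => h.
    rewrite mem_set // mulr1; congr Pr; apply/seteqP; split => [t []//|t ht].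
    by split => //=; rewrite ht.
  rewrite memNset // mulr0 (_ : _ `&` _ = set0) ?/Pr ?measure0 //.
  by apply/seteqP; split => [t [ht /=]|t] //; rewrite ht.
have mp := measurable_past N x.
have mpE : measurable (past X N x `&` X (N + n.+1)%N @^-1` Y) by exact: measurableI.
rewrite (Pr_partition (@mX N.+1) mpE (nbr_uniq (x N))) iterS.
(* the transition probabilities to the listed successors already add up to 1 *)
have -> : Pr P (past X N x `&` X (N + n.+1)%N @^-1` Y
    `&` X N.+1 @^-1` [set y | y \notin nbr (x N)]) = 0.
  apply/eqP; rewrite eq_le Pr_ge0 andbT.
  have := Pr_partition (@mX N.+1) mp (nbr_uniq (x N)).
  under eq_bigr do rewrite Pr_past_step.
  rewrite -mulr_sumr nbr_sum mulr1 -[LHS]addr0 => /addrI ->.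
  have mc : measurable (X N.+1 @^-1` [set y | y \notin nbr (x N)]).
    exact: measurable_preimage.
  apply: Pr_subset; [exact: measurableI|exact: measurableI|].
  by apply: setSI; exact: subIsetl.
rewrite addr0 /transition mulr_sumr; apply: eq_bigr => y _.
pose x' m := if (m <= N)%N then x m else y.
have px : past X N.+1 x' = past X N x `&` X N.+1 @^-1` [set y].
  apply/seteqP; split => t.
    move=> h; split => [m mN|] /=; last by rewrite h // /x' ltnn.
    by rewrite h ?/x' ?mN //; lia.
  move=> [h1 h2] m; rewrite leq_eqVlt => /orP[/eqP ->|]; first by rewrite /x' ltnn.
  by rewrite ltnS /x' => mN; rewrite mN; exact: h1.
rewrite setIAC -px addnS -addSn IH px Pr_past_step.
by rewrite /x' ltnn mulrA.
Qed.

Lemma Pr_chain (Y : set S) n :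
  Pr P (X n @^-1` Y) = iter n transition (fun s => (s \in Y)%:R) s0.
Proof.
have [_ h0 _] := chainX.
have p0 : past X 0 (fun=> s0) = X 0%N @^-1` [set s0].
  by apply/seteqP; split => [t h|t h [|m]] //; exact: h.
have mE : measurable (X n @^-1` Y) by exact: measurable_preimage.
rewrite (Pr_split mE (mX 0 s0)) -p0 setIC -[X n @^-1` Y]/(X (0 + n)%N @^-1` Y).
rewrite Pr_past_future p0 [Pr P (X 0%N @^-1` _)]h0 mul1r.
rewrite [X in _ + X](_ : _ = 0) ?addr0 //.
apply/eqP; rewrite eq_le Pr_ge0 andbT.
have mC : measurable (~` (X 0%N @^-1` [set s0])) by exact: measurableC.
apply: le_trans (Pr_subset _ mC (@subIsetr _ _ _)) _; first exact: measurableI.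
have := Pr_split measurableT (mX 0 s0).
rewrite !setTI [Pr P (X 0%N @^-1` _)]h0 {1}/Pr probability_setT /= -[LHS]addr0.
by move=> /addrI <-.
Qed.

End Probability.

Section Anisotropic.
Variables (R : realType) (p : int -> R).

Definition neighbours (a : int * int) : seq (int * int) :=
  [:: (a.1 + 1, a.2); (a.1 - 1, a.2); (a.1, a.2 + 1); (a.1, a.2 - 1)].

Lemma neighbours_uniq a : uniq (neighbours a).
Proof.
case: a => k j; rewrite /neighbours /= !inE !xpair_eqE !andbT.
apply/andP; split; last apply/andP; last split; last by apply/negP => /eqP; lia.
- by rewrite !negb_or !negb_and; apply/and3P; split; lia.
- by rewrite !negb_or !negb_and; apply/andP; split; lia.
Qed.

Definition plane_avg (f : int * int -> R) (a : int * int) : R :=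
  (2^-1 - p a.2) * (f (a.1 + 1, a.2) + f (a.1 - 1, a.2)) +
  p a.2 * (f (a.1, a.2 + 1) + f (a.1, a.2 - 1)).

Lemma transition_plane f a :
  transition (aniso_step p) neighbours f a = plane_avg f a.
Proof.
case: a => k j; rewrite /transition /neighbours !big_cons big_nil /plane_avg /=.
rewrite /aniso_step !eqxx !xpair_eqE !eqxx !orbT !andbT.
have -> : (k == k + 1) = false by lia.
have -> : (k == k - 1) = false by lia.
by rewrite /=; ring.
Qed.

Lemma aniso_step_sum a : \sum_(y <- neighbours a) aniso_step p a y = 1.
Proof.
have := transition_plane (fun=> 1) a; rewrite /transition.
under eq_bigr do rewrite mulr1.
by move=> ->; rewrite /plane_avg; field.
Qed.

Lemma Pr_walk (d : measure_display) (T : measurableType d) (P : probability T R)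
    (C : nat -> T -> int * int) (Y : set (int * int)) n :
  anisotropic_walk P p C ->
  Pr P (C n @^-1` Y) = iter n plane_avg (fun s => (s \in Y)%:R) (0, 0).
Proof.
move=> walkC; rewrite (Pr_chain walkC neighbours_uniq aniso_step_sum).
by rewrite (funext (fun f => funext (transition_plane f))).
Qed.

Lemma iter_plane_vert n (f : int -> R) a :
  iter n plane_avg (fun b => f b.2) a = vert p n f a.2.
Proof.
elim: n a => [//|n IH] a; rewrite iterS /plane_avg !IH /vert expectS /avg /=.
by field.
Qed.

(** The averaging operator of the plane is intertwined with that of the pairs
    (number of horizontal steps, height): given the vertical motion, the
    horizontal one is a simple walk run for the number of horizontal steps. *)
Lemma iter_plane_count n (f : int * int -> R) x k :
  count p n (fun y => srw y.1 (fun i => f (i, y.2)) k) x =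
  srw x.1 (fun i => iter n plane_avg f (i, x.2)) k.
Proof.
elim: n f => [//|n IH] f; rewrite /count expectSr.
transitivity (count p n (fun y => srw y.1 (fun i => plane_avg f (i, y.2)) k) x).
  apply: eq_expect => -[h j]; rewrite /avg /= /srw /vert expectSr -!expectD -!expectZ -expectD.
  by apply: eq_expect => i; rewrite /avg /plane_avg /=; field.
by rewrite IH; congr (srw _ _ _); apply/funext => i; rewrite -iterSr.
Qed.

Lemma Pr_vertical (d : measure_display) (T : measurableType d) (P : probability T R)
    (C : nat -> T -> int * int) n : anisotropic_walk P p C ->
  Pr P [set t | (C n t).2 = 0] = vert p n (delta R 0) 0.
Proof.
move=> walkC; rewrite -[[set t | _]]/(C n @^-1` [set a | a.2 = 0]) Pr_walk //.
rewrite -[RHS](@iter_plane_vert n (delta R 0) (0, 0)); congr (iter _ _ _ _).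
apply/funext => -[k j]; rewrite /delta /=; congr (_%:R); congr nat_of_bool.
by apply/idP/eqP => [/set_mem//|?]; apply/mem_set.
Qed.

Lemma Pr_origin (d : measure_display) (T : measurableType d) (P : probability T R)
    (C : nat -> T -> int * int) n : anisotropic_walk P p C ->
  Pr P [set t | C n t = (0, 0)] =
  count p n (fun x => ret R x.1 * delta R 0 x.2) (0%N, 0).
Proof.
move=> walkC; rewrite -[[set t | _]]/(C n @^-1` [set (0, 0)]) Pr_walk //.
pose f (a : int * int) : R := delta R 0 a.1 * delta R 0 a.2.
rewrite (_ : (fun s => _) = f); last first.
  apply/funext => -[k j]; rewrite /f /delta /= -natrM mulnb; congr (_%:R); congr nat_of_bool.
  apply/idP/andP => [/set_mem [-> ->]//|[/eqP -> /eqP ->]]; exact/mem_set.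
have := iter_plane_count n f (0%N, 0) 0; rewrite [RHS]/=.
rewrite {2}/srw {1}/vert {1}/expect /= => <-.
apply: eq_expect => -[h j] /=.
rewrite /f /= mulrC /ret /srw /vert -expectZ; apply: eq_expect => i; exact: mulrC.
Qed.

End Anisotropic.

(** * Time change of the vertical coordinate *)

Section TimeChange.
Variables (R : realType) (p : int -> R).
Hypothesis p_gt0 : forall j, 0 < p j.
Hypothesis p_le2 : forall j, p j <= 2^-1.
Let p_ge0 j : 0 <= p j. Proof. exact: ltW. Qed.

Let srw_ge0 n j : 0 <= srw n (delta R 0) j.
Proof. by apply: vert_delta_ge0 => // i; rewrite invr_gt0. Qed.

(** At time [m] with [h] horizontal steps, [m - h] vertical steps have been made.
    The mean of [|j|] after [L + K - (m - h)] further steps of a simple walk is a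
    martingale until [K] vertical steps have been made.  From then on the number
    of further steps stays equal to [L], as the subtractions are truncated, and
    the drift is a multiple of [srw L (delta R 0) j]: it is small when [L] is
    large, and the term in [b] can compensate it. *)
Lemma avg_time_change (L K m h : nat) (j : int) (b : R) : (h <= m)%N ->
  cavg p (fun y => mean_abs R (L + (K - (m.+1 - y.1))) y.2 - b * (m.+1 - y.1 - K)%:R) (h, j)
  = mean_abs R (L + (K - (m - h))) j - b * (m - h - K)%:R
    + (if (K <= m - h)%N then 2 * p j * (srw L (delta R 0) j - b) else 0).
Proof.
move=> hm; rewrite /cavg /avg /= subSS (subSn hm).
set a := (m - h)%N.
have two n : mean_abs R n (j + 1) + mean_abs R n (j - 1) = 2 * mean_abs R n.+1 j.
  by rewrite mean_absS; field.
rewrite addrACA two; case: leqP => Ka.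
  rewrite (_ : K - a.+1 = 0)%N; last by lia.
  rewrite (_ : K - a = 0)%N; last by lia.
  rewrite (_ : a.+1 - K = (a - K).+1)%N; last by lia.
  by rewrite !addn0 mean_abs_succ -natr1; ring.
rewrite (_ : (L + (K - a.+1)).+1 = L + (K - a))%N; last by lia.
rewrite (_ : a.+1 - K = 0)%N; last by lia.
rewrite (_ : a - K = 0)%N; last by lia.
ring.
Qed.

Lemma count_supermartingale (F : nat -> nat * int -> R) n :
  (forall m h j, (h <= m)%N -> cavg p (F m.+1) (h, j) <= F m (h, j)) ->
  count p n (F n) (0%N, 0) <= F 0%N (0%N, 0).
Proof.
move=> dF.
have Istep m (x : nat * int) : (x.1 <= m)%N ->
    [/\ (x.1.+1 <= m.+1)%N, (x.1 <= m.+1)%N & (x.1 <= m.+1)%N].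
  by move=> xm; split; lia.
have := @expect_drift R _ (fun x : nat * int => p x.2)
  (fun x => (x.1.+1, x.2)) (fun x => (x.1, x.2 + 1)) (fun x => (x.1, x.2 - 1))
  (fun x => p_ge0 x.2) (fun x => p_le2 x.2)
  (fun m x => (x.1 <= m)%N) Istep F (fun _ _ => 0) n (0%N, 0) isT.
rewrite [X in _ <= _ + X]big1; last by move=> m _; exact: expect_cst.
by rewrite addr0; apply => m [h j] _ hm; rewrite addr0; exact: dF.
Qed.

Lemma vert_abs_upper (l K n : nat) : (0 < l)%N ->
  vert p n (fun j => `|j|%:~R) 0 <= mean_abs R (2 * l + K) 0 +
    4 / Num.sqrt l%:R * count p n (fun x => (n - x.1 - K)%:R) (0%N, 0).
Proof.
move=> l0; set b := 4 / _.
have s0 : 0 < Num.sqrt l%:R :> R by rewrite sqrtr_gt0 ltr0n.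
pose F (m : nat) (x : nat * int) :=
  mean_abs R (2 * l + (K - (m - x.1))) x.2 - b * (m - x.1 - K)%:R.
have FE : count p n (F n) (0%N, 0) <= mean_abs R (2 * l + K) 0.
  apply: le_trans (_ : F 0%N (0%N, 0) <= _); last first.
    by rewrite /F /= !sub0n subn0 mulr0 subr0.
  apply: count_supermartingale => m h j hm; rewrite /F avg_time_change //= gerDl.
  case: ifP => // _; rewrite pmulr_rle0 ?mulr_gt0 //.
  by rewrite subr_le0 /b ler_pdivlMr //; exact: srw_even_sup.
apply: le_trans (lerD FE (lexx _)).
rewrite -(count_vert p n (fun j => `|j|%:~R) (0%N, 0)) /count -expectZ -expectD.
by apply: ler_expect => // x; rewrite subrK mean_abs_ge.
Qed.

Lemma vert_abs_lower (L K n : nat) :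
  mean_abs R (L + K) 0 <= vert p n (fun j => `|j|%:~R) 0 +
    Num.sqrt (L%:R + count p n (fun x => (K - (n - x.1))%:R) (0%N, 0)).
Proof.
pose F (m : nat) (x : nat * int) := - mean_abs R (L + (K - (m - x.1))) x.2.
have FE : count p n (F n) (0%N, 0) <= - mean_abs R (L + K) 0.
  apply: le_trans (_ : F 0%N (0%N, 0) <= _); last by rewrite /F /= sub0n subn0.
  apply: count_supermartingale => m h j hm; rewrite /F.
  have := @avg_time_change L K m h j 0 hm.
  under eq_fun do rewrite mul0r subr0.
  rewrite mul0r subr0 subr0 => e.
  have -> : cavg p (fun x => - mean_abs R (L + (K - (m.+1 - x.1))) x.2) (h, j) =
     - cavg p (fun x => mean_abs R (L + (K - (m.+1 - x.1))) x.2) (h, j).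
    by rewrite /cavg /avg; ring.
  rewrite e lerN2 lerDl; case: ifP => // _.
  by rewrite mulr_ge0 ?mulr_ge0.
have q : count p n (fun x => Num.sqrt (L + (K - (n - x.1)))%:R) (0%N, 0) <=
    Num.sqrt (L%:R + count p n (fun x => (K - (n - x.1))%:R) (0%N, 0)).
  apply: expect_le_sqrt => //.
  rewrite -[L%:R in leRHS](@expect_cst _ _ (fun x : nat * int => p x.2)
    (fun x => (x.1.+1, x.2)) (fun x => (x.1, x.2 + 1)) (fun x => (x.1, x.2 - 1)) n _ (0%N, 0)).
  rewrite -expectD; apply: ler_expect => // x.
  by rewrite sqr_sqrtr // natrD.
rewrite lerNr in FE; apply: le_trans FE _.
apply: le_trans (lerD (lexx _) q).
rewrite -(count_vert p n (fun j => `|j|%:~R) (0%N, 0)) /count -expectD -[leLHS]mulN1r -expectZ.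
by apply: ler_expect => // x; rewrite /F mulN1r opprK mean_abs_le.
Qed.

Variable gamma : R.
Hypothesis gamma_gt1 : 1 < gamma.
Hypothesis mean_pos : mean_to_zero (fun i => (p i%:Z)^-1 - 2 * gamma).
Hypothesis mean_neg : mean_to_zero (fun i => (p (- i%:Z))^-1 - 2 * gamma).

(** The bounds above are used with [K] close to the typical number
    [2 * M / gamma] of vertical steps, and with a smoothing time [2 * l] that is
    a small fraction of [M], yet large compared with the mean deviation of the
    number of vertical steps from [K]. *)
Lemma vert_abs_close eps : 0 < eps -> exists n0 : nat, forall M, (n0 <= M)%N ->
  `|vert p (2 * M) (fun j => `|j|%:~R) 0
    - mean_abs R (2 * Num.truncn (M%:R / gamma)) 0| <= eps * Num.sqrt M%:R.
Proof.
move=> eps0; have g1 := gamma_gt1.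
pose del := (eps / 10) ^+ 2.
have del0 : 0 < del by rewrite /del exprn_gt0 //; lra.
have [|n1 hn1] := count_mean p_gt0 p_le2 gamma_gt1 mean_pos mean_neg (eps := del / 2).
  by lra.
exists (n1 + (Num.truncn (4 / del)).+1)%N => M hM.
have n1M : (n1 <= 2 * M)%N by clear -hM; lia.
set n := (2 * M)%N in n1M *; set K := (2 * _)%N.
have nM : n%:R = 2 * M%:R :> R by rewrite natrM.
have Mbig : 4 / del <= M%:R.
  apply: le_trans (_ : (Num.truncn (4 / del)).+1%:R <= _); last by rewrite ler_nat; clear -hM; lia.
  by apply/ltW; rewrite truncnS_gt.
have {hM Mbig} dM : 4 <= del * M%:R by rewrite mulrC -ler_pdivrMr.
have M0 : 0 <= M%:R :> R by [].
have ginv : 0 < gamma^-1 by rewrite invr_gt0; lra.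
have xge0 : 0 <= M%:R / gamma by rewrite divr_ge0 //; lra.
have K1 : K%:R <= n%:R / gamma.
  rewrite /K /n !natrM -mulrA ler_pM2l //. by rewrite truncn_le.
have K2 : n%:R / gamma <= K%:R + 2.
  rewrite /K /n !natrM -mulrA -[X in _ + X]mulr1 -mulrDr ler_pM2l // natr1.
  by apply/ltW; rewrite truncnS_gt.
clearbody n K.
have D : count p n (fun x => `|x.1%:R - (1 - gamma^-1) * n%:R| + 2) (0%N, 0) <= 2 * del * M%:R.
  rewrite /count expectD expect_cst -/(count _ _ _).
  by have := hn1 n n1M; rewrite nM; lra.
have Dup : count p n (fun x => (n - x.1 - K)%:R) (0%N, 0) <= 2 * del * M%:R.
  apply: le_trans D; apply: ler_expect => // -[h j] /=.
  have [hK|hK] := leqP (h + K)%N n.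
    rewrite !natrB; [|clear -hK; lia..].
    have := ler_norm (- (h%:R - (1 - gamma^-1) * n%:R)); rewrite normrN; lra.
  rewrite (_ : n - h - K = 0)%N; last by clear -hK; lia.
  by rewrite addr_ge0.
have Dlow : count p n (fun x => (K - (n - x.1))%:R) (0%N, 0) <= 2 * del * M%:R.
  apply: le_trans D; apply: ler_expect => // -[h j] /=.
  have := ler_norm (h%:R - (1 - gamma^-1) * n%:R).
  have [hn|hn] := leqP h n; last first.
    rewrite (_ : n - h = 0)%N; last by clear -hn; lia.
    have : n%:R <= h%:R :> R by rewrite ler_nat ltnW.
    rewrite subn0; lra.
  have [hK|hK] := leqP (n - h)%N K; first by rewrite !natrB //; lra.
  rewrite (_ : K - (n - h) = 0)%N; last by clear -hK; lia.
  by move=> _; rewrite addr_ge0.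
(* all errors are multiples of [w], by the choice of [l] between [w ^+ 2] and
   twice that *)
pose w := eps / 10 * Num.sqrt M%:R.
have ww : w ^+ 2 = del * M%:R by rewrite /w exprMn sqr_sqrtr.
have w0 : 0 < w by rewrite mulr_gt0 ?sqrtr_gt0; [|lra|]; nra.
have sq a c : 0 <= c -> a <= (c * w) ^+ 2 -> Num.sqrt a <= c * w.
  move=> c0 ac; have cw0 : 0 <= c * w by rewrite mulr_ge0 // ltW.
  rewrite -[leRHS]ger0_norm //.
  by rewrite -sqrtr_sqr ler_wsqrtr.
pose l := (Num.truncn (del * M%:R)).+1.
have l1 : del * M%:R <= l%:R by apply/ltW; rewrite truncnS_gt.
have l2 : l%:R <= 2 * (del * M%:R).
  have : (Num.truncn (del * M%:R))%:R <= del * M%:R by rewrite truncn_le // mulr_ge0 // ltW.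
  by rewrite /l -natr1; lra.
have l0 : (0 < l)%N by [].
clearbody l.
have up := @vert_abs_upper l K n l0.
have low := vert_abs_lower (2 * l) K n.
have add := @mean_abs_add_le R K (2 * l).
rewrite addnC in add.
have mono : mean_abs R K 0 <= mean_abs R (2 * l + K) 0 by apply: mean_abs_mono; exact: leq_addl.
have s1 : Num.sqrt (2 * l)%:R <= 2 * w by apply: sq => //; rewrite natrM exprMn ww; lra.
have s2 : w <= Num.sqrt l%:R.
  by rewrite -[leLHS]ger0_norm ?(ltW w0) // -sqrtr_sqr ler_wsqrtr // ww.
have s3 : 4 / Num.sqrt l%:R * count p n (fun x => (n - x.1 - K)%:R) (0%N, 0) <= 8 * w.
  apply: le_trans (_ : 4 / w * (2 * del * M%:R) <= _).
    apply: ler_pM; [by rewrite divr_ge0 ?sqrtr_ge0|by apply: expect_ge0 => // x| |exact: Dup].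
    by rewrite ler_pM2l // lef_pV2 // posrE ?sqrtr_gt0 ?ltr0n.
  rewrite -(mulrA 2) -ww; clearbody w.
  have -> : 4 / w * (2 * w ^+ 2) = 8 * w by field; rewrite gt_eqF.
  by [].
have s4 : Num.sqrt ((2 * l)%:R + count p n (fun x => (K - (n - x.1))%:R) (0%N, 0)) <= 3 * w.
  by apply: sq => //; rewrite natrM exprMn ww; lra.
have -> : eps * Num.sqrt M%:R = 10 * w by rewrite /w; field.
by rewrite ler_norml; apply/andP; split; lra.
Qed.

End TimeChange.

(** * Limits of sequences *)

Section Limits.
Variable R : realType.

Lemma cvg_seqP (f : nat -> R) (l : R) :
  (forall eps, 0 < eps -> exists n0 : nat, forall n, (n0 <= n)%N -> `|f n - l| <= eps)
  <-> f n @[n --> \oo] --> l.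
Proof.
split=> [h|/cvgrPdist_le h eps eps0].
  apply/cvgrPdist_le => eps eps0; have [n0 hn0] := h eps eps0.
  by exists n0 => // n /= n0n; rewrite distrC; exact: hn0.
have [n0 _ hn0] := h eps eps0; exists n0 => n n0n; rewrite distrC; exact: hn0.
Qed.

Lemma truncn_large (a : R) n : ((Num.truncn a).+1 <= n)%N -> a <= n%:R.
Proof.
move=> an; apply: le_trans (_ : (Num.truncn a).+1%:R <= _); last by rewrite ler_nat.
by apply/ltW; rewrite truncnS_gt.
Qed.

Lemma cvg_over_sqrt (b : nat -> R) K : (forall n, `|b n| <= K) ->
  b n / Num.sqrt n%:R @[n --> \oo] --> (0 : R).
Proof.
move=> bK; apply/cvg_seqP => eps eps0.
have K0 : 0 <= K by apply: le_trans (bK 0%N).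
exists (Num.truncn ((K / eps) ^+ 2)).+1 => n hn.
have n0 : 0 < Num.sqrt n%:R :> R by rewrite sqrtr_gt0 ltr0n; lia.
rewrite subr0 normrM normfV (gtr0_norm n0) ler_pdivrMr //.
apply: le_trans (bK n) _; rewrite mulrC -ler_pdivrMr //.
rewrite -[leLHS]ger0_norm ?divr_ge0 ?(ltW eps0) // -sqrtr_sqr ler_wsqrtr //.
exact: truncn_large.
Qed.

(** A term of a nonincreasing sequence is enclosed between its averages over
    windows just before and just after it.  The windows are short compared with
    [n], but long enough for the asymptotics of the partial sums to determine
    these averages. *)
Lemma monotone_sqrt_density (e : nat -> R) (c : R) :
  (forall n, e n.+1 <= e n) -> 0 <= c ->
  (\sum_(m < n) e m) / Num.sqrt n%:R @[n --> \oo] --> c ->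
  e n * Num.sqrt n%:R @[n --> \oo] --> c / 2.
Proof.
move=> edec c0 /cvg_seqP Ec; apply/cvg_seqP => eta eta0.
pose E n := \sum_(m < n) e m.
have ES n : E n.+1 = E n + e n by rewrite /E big_ord_recr.
have emono m n : (m <= n)%N -> e n <= e m.
  move=> /subnK <-; elim: (_ - _)%N => [//|k IH].
  by rewrite addSn; apply: le_trans (edec _) IH.
have Eup l n : E (n + l)%N - E n <= l%:R * e n.
  elim: l => [|l IH]; first by rewrite addn0 subrr mul0r.
  rewrite addnS ES -natr1.
  have := emono n (n + l)%N (leq_addr _ _); lra.
have Elow l n : l%:R * e (n + l)%N <= E (n + l)%N - E n.
  have : forall i, (i <= l)%N -> i%:R * e (n + l)%N <= E (n + i)%N - E n.
    elim=> [|i IH] il; first by rewrite addn0 subrr mul0r.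
    rewrite addnS ES -natr1.
    have := emono (n + i)%N (n + l)%N ltac:(lia); have := IH ltac:(lia); lra.
  by apply.
pose del := eta / (c + eta).
have ce0 : 0 < c + eta by lra.
have del0 : 0 < del by rewrite divr_gt0.
have del1 : del <= 1 by rewrite ler_pdivrMr // mul1r; lra.
have dele : del * (c + eta) = eta by rewrite divfK // gt_eqF.
pose eps := del * eta / 24.
have eps0 : 0 < eps by rewrite /eps divr_gt0 // mulr_gt0.
have [n1 hn1] := Ec eps eps0.
have Ebd n : (n1 <= n)%N -> `|E n - c * Num.sqrt n%:R| <= eps * Num.sqrt n%:R.
  move=> n1n; have := hn1 n n1n.
  have [->|n0] := posnP n; first by rewrite /E big_ord0 sqrtr0 !mulr0 subr0 normr0.
  have s0 : 0 < Num.sqrt n%:R :> R by rewrite sqrtr_gt0 ltr0n.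
  have -> : E n - c * Num.sqrt n%:R = (E n / Num.sqrt n%:R - c) * Num.sqrt n%:R.
    by rewrite mulrBl divfK // gt_eqF.
  by rewrite normrM (gtr0_norm s0) ler_pM2r.
exists (2 * n1 + (Num.truncn (2 / del)).+1)%N => M hM.
have /truncn_large Mbig : ((Num.truncn (2 / del)).+1 <= M)%N by clear -hM; lia.
rewrite ler_pdivrMr // mulrC in Mbig.
have M0 : 0 <= M%:R :> R by [].
(* windows of length about [del * M / 2] on both sides of [M] *)
pose L := Num.truncn (del / 2 * M%:R).
have L1 : L%:R <= del / 2 * M%:R by rewrite truncn_le mulr_ge0 //; lra.
have L2 : del / 2 * M%:R <= 2 * L%:R.
  have h1 : del / 2 * M%:R <= L.+1%:R by apply/ltW; rewrite truncnS_gt.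
  have h2 : 1 <= L%:R :> R.
    by rewrite (ler_nat _ 1 L) truncn_gt0; lra.
  by move: h1; rewrite -natr1; lra.
have LM : (2 * L <= M)%N.
  by rewrite -(ler_nat R) natrM; nra.
have n1M : (n1 <= M)%N by clear -hM; lia.
have n1L : (n1 <= M - L)%N by clear -hM LM; lia.
have LM' : (L <= M)%N by clear -LM; lia.
clearbody L; clear hM hn1.
have EL := Elow L (M - L)%N; rewrite subnK // in EL.
have EU := Eup L M.
have B0 := Ebd M n1M; have B1 := Ebd (M - L)%N n1L.
have B2 := Ebd (M + L)%N (leq_trans n1M (leq_addr _ _)).
set s := Num.sqrt M%:R in B0 *.
set t := Num.sqrt (M - L)%:R in B1.
set r := Num.sqrt (M + L)%:R in B2.
have s2 : s ^+ 2 = M%:R by rewrite sqr_sqrtr.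
have t2 : t ^+ 2 = M%:R - L%:R by rewrite sqr_sqrtr // natrB.
have r2 : r ^+ 2 = M%:R + L%:R by rewrite sqr_sqrtr // natrD.
have s0 : 0 < s by rewrite sqrtr_gt0; nra.
have t0 : 0 <= t by exact: sqrtr_ge0.
have r0 : 0 <= r by exact: sqrtr_ge0.
have L0 : 0 < L%:R :> R by nra.
have ts : t <= s by rewrite -ler_sqr ?nnegrE ?(ltW s0) // t2 s2; lra.
have sr : s <= r by rewrite -ler_sqr ?nnegrE ?(ltW s0) // r2 s2; lra.
have tlow : (1 - del) * s <= t.
  rewrite -ler_sqr ?nnegrE //; last by apply: mulr_ge0; lra.
  by rewrite exprMn t2 s2; nra.
have rup : r <= (1 + del) * s.
  rewrite -ler_sqr ?nnegrE //; last by apply: mulr_ge0; lra.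
  by rewrite exprMn r2 s2; nra.
have Ls : del * s ^+ 2 <= 4 * L%:R by rewrite s2; lra.
have sL : L%:R = (s - t) * (s + t) by rewrite -subr_sqr t2 s2; ring.
have rL : L%:R = (r - s) * (r + s) by rewrite -subr_sqr r2 s2; ring.
move: B0 B1 B2; rewrite !ler_norml => /andP[B0 B0'] /andP[B1 B1'] /andP[B2 B2'].
have up : L%:R * e M <= c * (s - t) + 2 * eps * s by nra.
have low : c * (r - s) - eps * (r + s) <= L%:R * e M by nra.
have cd : c * del <= eta by rewrite -dele; nra.
have epsL : 6 * eps * s ^+ 2 <= L%:R * eta.
  have := ler_wpM2r (ltW eta0) Ls; rewrite /eps; lra.
have quad a b : 0 <= b - a -> b - a <= del * s -> (b - a) * s <= L%:R ->
    c * (b - a) ^+ 2 <= L%:R * eta.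
  move=> h1 h2 h3; apply: le_trans (_ : c * (del * (L%:R)) <= _).
    apply: ler_wpM2l => //; apply: le_trans (_ : del * ((b - a) * s) <= _).
      by rewrite expr2; nra.
    by rewrite ler_pM2l.
  by rewrite mulrA mulrC ler_wpM2l // ltW.
have q1 : c * (s - t) ^+ 2 <= L%:R * eta.
  apply: quad; [by rewrite subr_ge0|lra|].
  by rewrite sL ler_wpM2l ?subr_ge0 // lerDl.
have q2 : c * (r - s) ^+ 2 <= L%:R * eta.
  apply: quad; [by rewrite subr_ge0|lra|].
  by rewrite rL ler_wpM2l ?subr_ge0 // lerDr.
apply/andP; split; rewrite -(ler_pM2l L0).
  have hc : L%:R * (c / 2) = c * ((r - s) * (r + s)) / 2 by rewrite -rL; ring.
  have hr : eps * s * r <= 2 * eps * s ^+ 2.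
    have rs : r <= 2 * s by clear -rup del1 s0; nra.
    have es : 0 <= eps * s by rewrite mulr_ge0 ?ltW.
    have := ler_wpM2l es rs; clear; lra.
  have := ler_wpM2r (ltW s0) low; clear -q2 epsL hr hc; lra.
have hc : L%:R * (c / 2) = c * ((s - t) * (s + t)) / 2 by rewrite -sL; ring.
have Le : 0 <= L%:R * eta by rewrite mulr_ge0 // ltW.
have := ler_wpM2r (ltW s0) up; clear -q1 epsL hc Le; lra.
Qed.

End Limits.

(** * Return probabilities of the vertical coordinate *)

Section ReturnLimits.
Variable R : realType.

Lemma ret_cvg :
  ret R (2 * m) * Num.sqrt m%:R @[m --> \oo] --> (Num.sqrt pi)^-1.
Proof.
have pi0 := @pi_gt0 R.
rewrite -sqrtrV ?(ltW pi0) //.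
have sq : (ret R (2 * m) ^+ 2 * m%:R) @[m --> \oo] --> (pi : R)^-1.
  apply/cvg_seqP => eps eps0; exists (Num.truncn (1 / eps)).+1 => m hm.
  have m0 : 0 < m%:R :> R by rewrite ltr0n; lia.
  have me : 1 <= eps * m%:R.
    by rewrite mulrC -ler_pdivrMr //; exact: truncn_large.
  have lo := @ret_lower R m; have up := @ret_upper R m.
  set x := ret R (2 * m) in lo up *.
  rewrite ler_norml; apply/andP; split; rewrite -(ler_pM2l pi0) mulrBr mulfV ?gt_eqF //.
    have h1 : pi * x ^+ 2 <= 2 * eps.
      rewrite -(ler_pM2r m0); have := up; nra.
    have p1 := @pi_ge2 R.
    have : 2 <= 2 * (pi * (x ^+ 2 * m%:R)) + pi * x ^+ 2.
      by move: lo; rewrite -[(2 * m).+1%:R]natr1 natrM; lra.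
    nra.
  by apply: le_trans (_ : 0 <= _); [lra|rewrite mulr_ge0 // ltW].
apply: (cvg_trans _ (cvg_comp _ _ sq (@sqrt_continuous R _))).
apply: near_eq_cvg; apply: nearW => m /=.
by rewrite sqrtrM ?sqr_ge0 // sqrtr_sqr ger0_norm // ret_ge0.
Qed.

Lemma mean_abs_cvg gamma : 1 < gamma ->
  mean_abs R (2 * Num.truncn (M%:R / gamma)) 0 / Num.sqrt M%:R @[M --> \oo]
  --> 2 / Num.sqrt (pi * gamma).
Proof.
move=> g1; have g0 : 0 < gamma by lra.
pose k M := Num.truncn (M%:R / gamma : R).
have kc : k M @[M --> \oo] --> \oo.
  apply/cvgnyPge => A; exists (Num.truncn (A%:R * gamma)).+1 => // M /= hM.
  rewrite /k truncn_ge_nat; last by rewrite divr_ge0 // ltW.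
  by rewrite ler_pdivlMr //; exact: truncn_large.
have c1 : ret R (2 * k M) * Num.sqrt (k M)%:R @[M --> \oo] --> (Num.sqrt pi)^-1.
  exact: (cvg_comp _ _ kc ret_cvg).
have c2 : (k M)%:R / M%:R @[M --> \oo] --> gamma^-1.
  apply/cvg_seqP => eps eps0; exists (Num.truncn (1 / eps)).+1 => M hM.
  have M0 : 0 < M%:R :> R by rewrite ltr0n; lia.
  have me : 1 <= eps * M%:R.
    by rewrite mulrC -ler_pdivrMr //; exact: truncn_large.
  have l1 : (k M)%:R <= M%:R / gamma by rewrite truncn_le divr_ge0 // ltW.
  have l2 : M%:R / gamma <= (k M)%:R + 1 by rewrite natr1; apply/ltW; rewrite truncnS_gt.
  have -> : (k M)%:R / M%:R - gamma^-1 = ((k M)%:R - M%:R / gamma) / M%:R.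
    by field; rewrite !gt_eqF.
  rewrite normrM normfV (gtr0_norm M0) ler_pdivrMr // ler_norml.
  by apply/andP; split; lra.
have c3 : Num.sqrt ((k M)%:R / M%:R) @[M --> \oo] --> Num.sqrt gamma^-1.
  exact: (cvg_comp _ _ c2 (@sqrt_continuous R _)).
have c4 := cvgM (cvgM (cvg_cst (2 : R)) c1) c3.
have -> : 2 / Num.sqrt (pi * gamma) = 2 * (Num.sqrt pi)^-1 * Num.sqrt gamma^-1.
  rewrite sqrtrM ?pi_ge0 // sqrtrV ?(ltW g0) // invfM; ring.
apply: cvg_trans; last exact: c4. apply: near_eq_cvg; exists 1%N => // M /= M1.
have M0 : 0 < Num.sqrt M%:R :> R by rewrite sqrtr_gt0 ltr0n.
rewrite /= mean_abs_zero -/(k M) natrM sqrtrM // sqrtrV //.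
rewrite -[X in 2 * X * ret _ _](@sqr_sqrtr R (k M)%:R) //; ring.
Qed.

Section VerticalReturn.
Variables (p : int -> R).
Hypothesis p_gt0 : forall j, 0 < p j.
Hypothesis p_le2 : forall j, p j <= 2^-1.
Variable gamma : R.
Hypothesis gamma_gt1 : 1 < gamma.
Hypothesis mean_pos : mean_to_zero (fun i => (p i%:Z)^-1 - 2 * gamma).
Hypothesis mean_neg : mean_to_zero (fun i => (p (- i%:Z))^-1 - 2 * gamma).

Let u n := vert p n (delta R 0) 0.

Variable K : R.
Hypothesis even_odd : forall N, (0 < N)%N ->
  \sum_(1 <= m < N.+1) (u (2 * m + 2) - u (2 * m + 1)) <= K.

Let u_le1 n : u n <= 1.
Proof.
rewrite -[leRHS](expect_cst p id (fun j : int => j + 1) (fun j => j - 1) n 1 0).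
apply: ler_expect => // [j|j]; first exact: ltW.
by rewrite /delta; case: eqP => _ //; rewrite ler01.
Qed.

Let u_ge0 n : 0 <= u n.
Proof. exact: vert_delta_ge0. Qed.

(** The difference is the sum of [u (2 m) - u (2 m + 1)], which is nonnegative by
    reversibility, and at most the assumed bound up to a telescoping sum. *)
Lemma even_odd_bounded n :
  `|2 * (\sum_(m < n) u (2 * m)) - \sum_(k < 2 * n) u k| <= `|K| + 3.
Proof.
have split_sum : \sum_(k < 2 * n) u k = \sum_(m < n) (u (2 * m) + u (2 * m).+1).
  elim: n => [|n IH]; first by rewrite muln0 !big_ord0.
  have -> : (2 * n.+1 = (2 * n).+2)%N by lia.
  by rewrite !big_ord_recr /= IH -addrA.
have -> : 2 * (\sum_(m < n) u (2 * m)) - \sum_(k < 2 * n) u k =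
    \sum_(m < n) (u (2 * m) - u (2 * m).+1).
  rewrite split_sum mulr_sumr -sumrB; apply: eq_bigr => m _; ring.
rewrite ger0_norm; last first.
  by apply: sumr_ge0 => m _; rewrite subr_ge0; exact: vert_odd_le.
have K0 : 0 <= `|K| by [].
clear split_sum; case: n => [|n]; first by rewrite big_ord0; lra.
have tele : \sum_(m < n.+1) (u (2 * m) - u (2 * m).+1) + u (2 * n.+1)
   = u 0%N - u 1%N + u 2 + \sum_(1 <= m < n.+1) (u (2 * m + 2) - u (2 * m + 1)).
  elim: n => [|n IH].
    by rewrite big_ord_recr big_ord0 /= add0r big_geq // addr0 muln0 muln1.
  rewrite big_ord_recr big_nat_recr //= [RHS]addrA -IH.
  have -> : (2 * n.+2 = 2 * n.+1 + 2)%N by lia.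
  rewrite addn1; ring.
have KN : \sum_(1 <= m < n.+1) (u (2 * m + 2) - u (2 * m + 1)) <= `|K|.
  case: n {tele} => [|n]; first by rewrite big_geq.
  by apply: le_trans (even_odd _) (ler_norm _).
have := u_ge0 (2 * n.+1); have := u_ge0 1; have := u_le1 0; have := u_le1 2; lra.
Qed.

Lemma return_cvg :
  u (2 * n) * Num.sqrt n%:R @[n --> \oo] --> (4 * p 0 * Num.sqrt (pi * gamma))^-1.
Proof.
have p0 := p_gt0 0.
have g1 := gamma_gt1.
have s0 : 0 < Num.sqrt (pi * gamma) by rewrite sqrtr_gt0 mulr_gt0 ?pi_gt0 //; lra.
have -> : (4 * p 0 * Num.sqrt (pi * gamma))^-1 = (2 / Num.sqrt (pi * gamma) / (4 * p 0)) / 2.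
  by field; rewrite !gt_eqF.
apply: monotone_sqrt_density.
- by move=> n; exact: vert_even_decr.
- by rewrite divr_ge0 ?divr_ge0 ?sqrtr_ge0 // mulr_ge0 // ltW.
pose A n := vert p (2 * n) (fun j => `|j|%:~R) 0.
pose V n := mean_abs R (2 * Num.truncn (n%:R / gamma)) 0.
pose b n := 2 * (\sum_(m < n) u (2 * m)) - \sum_(k < 2 * n) u k.
have AS n : A n = 2 * p 0 * \sum_(k < 2 * n) u k.
  rewrite -vert_abs; congr (vert _ _ _ _); apply/funext => j; by rewrite subr0.
have close : (A n - V n) / Num.sqrt n%:R @[n --> \oo] --> (0 : R).
  apply/cvg_seqP => eps eps0.
  have [n0 hn0] := vert_abs_close p_gt0 p_le2 gamma_gt1 mean_pos mean_neg eps0.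
  exists n0.+1 => n hn; rewrite subr0.
  have sn : 0 < Num.sqrt n%:R :> R by rewrite sqrtr_gt0 ltr0n; lia.
  by rewrite normrM normfV (gtr0_norm sn) ler_pdivrMr //; apply: hn0; lia.
have bc := cvg_over_sqrt even_odd_bounded.
have Vc := mean_abs_cvg gamma_gt1.
have h := cvgD (cvgM (cvgD close Vc) (cvg_cst ((4 * p 0)^-1))) (cvgM bc (cvg_cst (2^-1 : R))).
rewrite add0r mul0r addr0 in h.
apply: cvg_trans; last exact: h.
apply: near_eq_cvg; apply: nearW => n.
have -> : \sum_(m < n) u (2 * m) = (b n + A n / (2 * p 0)) / 2.
  by rewrite AS /b; field; rewrite gt_eqF.
transitivity (((A n - V n) / Num.sqrt n%:R + V n / Num.sqrt n%:R) / (4 * p 0)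
  + b n / Num.sqrt n%:R / 2); first by [].
rewrite -mulrDl subrK; set s := (Num.sqrt _)^-1; field.
by rewrite gt_eqF.
Qed.

End VerticalReturn.
End ReturnLimits.

(** * Approximation of the simple return probabilities *)

Section Approximation.
Variable R : realType.

(** The size of [ret h] when [h] is too small for its asymptotics to be used. *)
Definition inv_sqrt_below (M h : nat) : R :=
  if (h < M)%N then (Num.sqrt h.+1%:R)^-1 else 0.

Lemma inv_sqrt_below_ge0 M h : 0 <= inv_sqrt_below M h.
Proof. by rewrite /inv_sqrt_below; case: ifP => // _; rewrite invr_ge0 sqrtr_ge0. Qed.

Lemma inv_sqrt_below_decr M h : inv_sqrt_below M h.+1 <= inv_sqrt_below M h.
Proof.
rewrite /inv_sqrt_below; case: ltnP => hM; last by exact: inv_sqrt_below_ge0.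
rewrite (ltnW hM) lef_pV2 ?posrE ?sqrtr_gt0 ?ltr0n // ler_wsqrtr //.
by rewrite ler_nat.
Qed.

Lemma sum_inv_sqrt_below M h :
  \sum_(i < h) inv_sqrt_below M i <= 2 * Num.sqrt M%:R.
Proof.
suff : \sum_(i < h) inv_sqrt_below M i <= 2 * Num.sqrt (minn h M)%:R.
  move=> /le_trans; apply; rewrite ler_pM2l // ler_wsqrtr // ler_nat geq_minr //.
elim: h => [|h IH]; first by rewrite big_ord0 mulr_ge0 ?sqrtr_ge0.
rewrite big_ord_recr /= {2}/inv_sqrt_below; case: ltnP => hM; last first.
  by rewrite addr0; move: IH; rewrite !(minn_idPr _) // ltnW.
move: IH; rewrite !(minn_idPl _) //; last exact: ltnW.
set s := Num.sqrt h%:R; set t := Num.sqrt h.+1%:R.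
have t0 : 0 < t by rewrite sqrtr_gt0 ltr0n.
have s0 : 0 <= s by exact: sqrtr_ge0.
have t2 : t ^+ 2 = s ^+ 2 + 1 by rewrite !sqr_sqrtr // natr1.
have : t^-1 <= 2 * (t - s).
  rewrite -(ler_pM2r t0) mulVf ?gt_eqF //.
  by have := sqr_ge0 (t - s); nra.
lra.
Qed.

Lemma ret_le_inv_sqrt k : ret R (2 * k) <= 2 / Num.sqrt (2 * k).+1%:R.
Proof.
have s0 : 0 < Num.sqrt (2 * k).+1%:R :> R by rewrite sqrtr_gt0 ltr0n.
have r0 := ret_ge0 R (2 * k); have up := @ret_upper R k.
rewrite ler_pdivlMr // -ler_sqr ?nnegrE //; last by rewrite mulr_ge0 // ltW.
rewrite exprMn sqr_sqrtr // -[(2 * k).+1%:R]natr1 natrM.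
have p2 := @pi_ge2 R.
set r := ret R (2 * k) in r0 up *.
have kr : 0 <= k%:R * r ^+ 2 by rewrite mulr_ge0 // sqr_ge0.
have kr2 : 2 * (k%:R * r ^+ 2) <= 1.
  by apply: le_trans up; rewrite -mulrA; apply: ler_wpM2r.
have r1 : r ^+ 2 <= 1.
  move: kr2; rewrite /r; case: (k) => [|i] h.
    by rewrite muln0 /ret /srw /vert /expect /= /delta eqxx expr1n.
  have i1 : 1 <= i.+1%:R :> R by rewrite ler1n.
  have := sqr_ge0 (ret R (2 * i.+1)); nra.
lra.
Qed.

Lemma inv_sqrt_dist (a b : R) : 0 < a -> 0 < b ->
  `|(Num.sqrt b)^-1 - (Num.sqrt a)^-1| <= `|b - a| / (Num.sqrt b * a).
Proof.
move=> a0 b0; set s := Num.sqrt a; set t := Num.sqrt b.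
have s0 : 0 < s by rewrite sqrtr_gt0.
have t0 : 0 < t by rewrite sqrtr_gt0.
have -> : `|b - a| / (t * a) = `|t ^+ 2 - s ^+ 2| / (t * s ^+ 2).
  by rewrite !sqr_sqrtr // ltW.
have -> : t^-1 - s^-1 = (s - t) / (s * t) by field; rewrite !gt_eqF.
rewrite normrM normfV [`|s * t|]gtr0_norm ?mulr_gt0 //.
rewrite subr_sqr normrM [`|t + s|]gtr0_norm ?addr_gt0 // distrC.
rewrite ler_pdivrMr ?mulr_gt0 //.
have -> : `|t - s| * (t + s) / (t * s ^+ 2) * (s * t) = `|t - s| * ((t + s) / s).
  by field; rewrite !gt_eqF.
by rewrite ler_peMr // ler_pdivlMr // mul1r lerDr ltW.
Qed.

(** The typical number of horizontal steps is [2 * kappa * N].  Below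
    [eta * N] steps only the order of magnitude of [ret] is used; above, the
    function [1 / sqrt] is Lipschitz at scale [N] and the relative error in the
    asymptotics of [ret] is small. *)
Lemma ret_approx (kappa eta eps : R) : 0 < kappa -> 0 < eta -> 0 < eps ->
  exists n0 : nat, forall N k, (n0 <= N)%N -> (k <= N)%N ->
  `|ret R (2 * k) - (Num.sqrt (pi * kappa * N%:R))^-1| <=
    (2 + 2 / Num.sqrt (pi * kappa)) *
      inv_sqrt_below (Num.truncn (eta * N%:R)).+1 (2 * k)
    + (2 * kappa * Num.sqrt (eta / 2))^-1 *
      `|(2 * k)%:R - kappa * (2 * N)%:R| / (N%:R * Num.sqrt N%:R)
    + eps / Num.sqrt N%:R.
Proof.
move=> kap0 eta0 eps0.
have pi0 := @pi_gt0 R; have pi2 := @pi_ge2 R.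
have e2 : 0 < Num.sqrt (eta / 2) by rewrite sqrtr_gt0 divr_gt0.
have [k0 hk0] := (cvg_seqP _ _).2 (@ret_cvg R) _ (mulr_gt0 eps0 e2).
exists (Num.truncn (2 * k0%:R / eta)).+1 => N k hN kN.
have N0 : 0 < N%:R :> R by rewrite ltr0n; clear -hN; lia.
have sN : 0 < Num.sqrt N%:R :> R by rewrite sqrtr_gt0.
have pk0 : 0 <= pi * kappa by rewrite mulr_ge0 // ltW.
have spk : 0 < Num.sqrt (pi * kappa) by rewrite sqrtr_gt0 mulr_gt0.
have Nk0 : 2 * k0%:R <= eta * N%:R.
  by rewrite [leRHS]mulrC -ler_pdivrMr //; exact: truncn_large.
have t2 : 0 <= (2 * kappa * Num.sqrt (eta / 2))^-1 *
      `|(2 * k)%:R - kappa * (2 * N)%:R| / (N%:R * Num.sqrt N%:R).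
  by rewrite divr_ge0 ?mulr_ge0 // ?invr_ge0 ?mulr_ge0 // ltW.
have t3 : 0 <= eps / Num.sqrt N%:R by rewrite divr_ge0 // ltW.
rewrite /inv_sqrt_below; case: ltnP => hM.
  apply: le_trans (_ : (2 + 2 / Num.sqrt (pi * kappa)) * (Num.sqrt (2 * k).+1%:R)^-1 <= _).
    apply: le_trans (ler_normB _ _) _; rewrite [leRHS]mulrDl; apply: lerD.
      by rewrite ger0_norm ?ret_ge0 // ret_le_inv_sqrt.
    rewrite ger0_norm ?invr_ge0 ?sqrtr_ge0 // sqrtrM // invfM.
    have h0 : 0 < Num.sqrt (2 * k).+1%:R :> R by rewrite sqrtr_gt0 ltr0n.
    rewrite [leRHS]mulrAC [leRHS]mulrC ler_pM2l ?invr_gt0 //.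
    rewrite ler_pdivlMr // mulrC ler_pdivrMr //.
    rewrite -ler_sqr ?nnegrE ?mulr_ge0 ?sqrtr_ge0 // exprMn !sqr_sqrtr //.
    rewrite -natrX -natrM ler_nat; move: hN kN; clear; lia.
  lra.
have kbig : eta / 2 * N%:R <= k%:R.
  have : eta * N%:R <= (2 * k)%:R by apply: truncn_large.
  by rewrite natrM; lra.
have kk0 : (k0 <= k)%N by rewrite -(ler_nat R); lra.
have kp : 0 < k%:R :> R by apply: lt_le_trans kbig; rewrite mulr_gt0 // divr_gt0.
have sk : 0 < Num.sqrt k%:R :> R by rewrite sqrtr_gt0.
have skN : Num.sqrt (eta / 2) * Num.sqrt N%:R <= Num.sqrt k%:R.
  by rewrite -sqrtrM ?ler_wsqrtr // divr_ge0 // ltW.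
have kapN : 0 < kappa * N%:R by rewrite mulr_gt0.
rewrite mulr0 add0r.
have -> : ret R (2 * k) - (Num.sqrt (pi * kappa * N%:R))^-1 =
   (ret R (2 * k) * Num.sqrt k%:R - (Num.sqrt pi)^-1) / Num.sqrt k%:R
   + (Num.sqrt pi)^-1 * ((Num.sqrt k%:R)^-1 - (Num.sqrt (kappa * N%:R))^-1).
  rewrite -mulrA sqrtrM ?(ltW pi0) //; field.
  by rewrite !gt_eqF ?sqrtr_gt0.
rewrite addrC; apply: le_trans (ler_normD _ _) _; apply: lerD.
  rewrite normrM [`|_^-1|]ger0_norm ?invr_ge0 ?sqrtr_ge0 //.
  apply: le_trans (_ : 1 * (`|k%:R - kappa * N%:R| / (Num.sqrt k%:R * (kappa * N%:R))) <= _).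
    apply: ler_pM; [by rewrite invr_ge0 sqrtr_ge0|by []| |exact: inv_sqrt_dist].
    by rewrite invf_le1 ?sqrtr_gt0 // -[leLHS](@sqrtr1 R) ler_wsqrtr //; lra.
  rewrite mul1r !natrM.
  have -> : 2 * k%:R - kappa * (2 * N%:R) = 2 * (k%:R - kappa * N%:R) by ring.
  rewrite normrM [`|2|]ger0_norm //.
  have -> : (2 * kappa * Num.sqrt (eta / 2))^-1 * (2 * `|k%:R - kappa * N%:R|) /
      (N%:R * Num.sqrt N%:R) =
      `|k%:R - kappa * N%:R| / (Num.sqrt (eta / 2) * Num.sqrt N%:R * (kappa * N%:R)).
    by field; rewrite !gt_eqF.
  apply: ler_wpM2l => //; rewrite lef_pV2 ?posrE ?mulr_gt0 //.
  by rewrite ler_pM2r.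
rewrite normrM [`|_^-1|]gtr0_norm ?invr_gt0 // ler_pdivrMr //.
apply: le_trans (hk0 k kk0) _.
by rewrite mulrAC ler_pdivlMr // -mulrA ler_pM2l.
Qed.

End Approximation.

(** * Horizontal steps on a return of the vertical coordinate *)

Section Conditioned.
Variables (R : realType) (p : int -> R).
Hypothesis p_gt0 : forall j, 0 < p j.
Hypothesis p_le2 : forall j, p j <= 2^-1.
Let p_ge0 j : 0 <= p j. Proof. exact: ltW. Qed.

(** Only the number of horizontal steps at time [n] is kept, and the last [2 * l]
    steps are used to pay for the return to [0]. *)
Lemma count_split n l (F G : nat -> R) :
  (forall h' h, (h' <= h <= h' + 2 * l)%N -> F h <= G h') ->
  count p (n + 2 * l) (fun x => F x.1 * delta R 0 x.2) (0%N, 0) <=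
  count p n (fun y => G y.1 * vert p (2 * l) (delta R 0) y.2) (0%N, 0).
Proof.
move=> FG; rewrite /count expect_add; apply: ler_expect => // y.
rewrite -(count_vert p (2 * l) (delta R 0) y) /count -expectZ.
apply: (ler_count_from p_gt0 p_le2) => x hx.
by apply: ler_wpM2r; [exact: delta_ge0|exact: FG].
Qed.

Variable omega : R.
Hypothesis omega_gt0 : 0 < omega.
Hypothesis p_ge : forall j, omega <= p j.

Let CK := (omega ^+ 2)^-1.
Let CK_gt0 : 0 < CK. Proof. by rewrite invr_gt0 exprn_gt0. Qed.

Lemma vert_sup l j c : 0 < c -> c <= Num.sqrt l%:R ->
  vert p (2 * l) (delta R 0) j <= CK / c.
Proof.
move=> c0 cl; have := vert_even_sup p_gt0 p_le2 omega_gt0 p_ge l j 0.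
rewrite -/CK ler_pdivlMr //; apply: le_trans.
by apply: ler_wpM2l => //; exact: vert_delta_ge0.
Qed.

Lemma count_split_sup n l c (F G : nat -> R) : 0 < c -> c <= Num.sqrt l%:R ->
  (forall h, 0 <= G h) ->
  (forall h' h, (h' <= h <= h' + 2 * l)%N -> F h <= G h') ->
  count p (n + 2 * l) (fun x => F x.1 * delta R 0 x.2) (0%N, 0) <=
  CK / c * count p n (fun y => G y.1) (0%N, 0).
Proof.
move=> c0 cl G0 FG; apply: le_trans (count_split n FG) _.
rewrite /count -expectZ; apply: ler_expect => // y; rewrite mulrC.
by apply: ler_wpM2r => //; exact: vert_sup.
Qed.

Variable gamma : R.
Hypothesis gamma_gt1 : 1 < gamma.
Hypothesis mean_pos : mean_to_zero (fun i => (p i%:Z)^-1 - 2 * gamma).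
Hypothesis mean_neg : mean_to_zero (fun i => (p (- i%:Z))^-1 - 2 * gamma).

Let u n := vert p (2 * n) (delta R 0) 0.

(** The splitting is made at about half of the time, so that the return costs
    [1 / sqrt N] and the first half controls the number of horizontal steps. *)
Lemma few_horizontal : exists2 C : R, 0 < C & forall N M, (2 <= N)%N -> (0 < M)%N ->
  count p (2 * N) (fun x => inv_sqrt_below R M x.1 * delta R 0 x.2) (0%N, 0)
    * (N%:R * Num.sqrt N%:R) <= C * (1 + Num.sqrt M%:R).
Proof.
have [K K0 hK] := count_small_horizontal p_gt0 p_le2 gamma_gt1 mean_pos mean_neg.
exists (4 * CK * K); first by rewrite !mulr_gt0.
move=> N M N2 M0; pose l := (N %/ 2)%N; pose n := (2 * N - 2 * l)%N.
have lN : (N <= 4 * l)%N by rewrite /l; lia.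
have nN : (N <= n)%N by rewrite /n /l; lia.
have -> : (2 * N = n + 2 * l)%N by rewrite /n /l; lia.
have N0 : 0 < N%:R :> R by rewrite ltr0n; lia.
have sN : 0 < Num.sqrt N%:R :> R by rewrite sqrtr_gt0.
clearbody n l.
have sl : Num.sqrt N%:R / 2 <= Num.sqrt l%:R :> R.
  rewrite ler_pdivrMr // -ler_sqr ?nnegrE ?mulr_ge0 ?sqrtr_ge0 //.
  by rewrite exprMn !sqr_sqrtr // -natrX -natrM ler_nat mulnC.
have sN2 : 0 < Num.sqrt N%:R / 2 :> R by rewrite divr_gt0.
have split := @count_split_sup n l _ (inv_sqrt_below R M) (inv_sqrt_below R M) sN2 sl
  (inv_sqrt_below_ge0 R M).
have {}split := split ltac:(idtac; first
  [ move=> h' h /andP[/subnK <- _]; elim: (_ - _)%N => [//|i IH];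
    rewrite addSn; exact: le_trans (inv_sqrt_below_decr _ _ _) IH ]).
have := hK (inv_sqrt_below R M) (2 * Num.sqrt M%:R) n (inv_sqrt_below_ge0 R M)
  (inv_sqrt_below_decr R M) (sum_inv_sqrt_below R M).
rewrite {2}/inv_sqrt_below M0 sqrtr1 invr1.
set E := count p n _ _ in split *; set X := count _ _ _ _ in split * => hE.
have E0 : 0 <= E by apply: expect_ge0 => // x; exact: inv_sqrt_below_ge0.
have NE : N%:R * E <= K * (1 + 2 * Num.sqrt M%:R).
  by apply: le_trans hE; apply: ler_wpM2r => //; rewrite ler_nat.
have -> : X * (N%:R * Num.sqrt N%:R) = N%:R * (X * Num.sqrt N%:R) by ring.
apply: le_trans (_ : N%:R * (2 * CK * E) <= _).
  rewrite ler_pM2l // -ler_pdivlMr //; apply: le_trans split _.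
  by rewrite le_eqVlt; apply/orP; left; apply/eqP; field; rewrite gt_eqF.
have -> : N%:R * (2 * CK * E) = 2 * CK * (N%:R * E) by ring.
apply: le_trans (_ : 2 * CK * (K * (1 + 2 * Num.sqrt M%:R)) <= _).
  by rewrite ler_pM2l // mulr_gt0.
have CKK : 0 < CK * K by rewrite mulr_gt0.
have := sqrtr_ge0 (M%:R : R); set m := Num.sqrt _ => m0; nra.
Qed.

Lemma return_bound N : (0 < N)%N -> u N <= CK / Num.sqrt N%:R.
Proof. by move=> N0; apply: vert_sup => //; rewrite sqrtr_gt0 ltr0n. Qed.

Let kappa := 1 - gamma^-1.

Let kappa_gt0 : 0 < kappa.
Proof. by rewrite /kappa subr_gt0 invf_lt1 // (lt_trans ltr01). Qed.

Let kappa_lt1 : kappa < 1.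
Proof. by rewrite /kappa gtrBl invr_gt0 (lt_trans ltr01). Qed.

(** The splitting is made close to the end, since the last [2 * l] steps change
    the number of horizontal steps by at most [2 * l], which must be a small
    fraction of [N]. *)
Lemma horizontal_concentration eps : 0 < eps -> exists n0 : nat, forall N, (n0 <= N)%N ->
  count p (2 * N) (fun x => `|x.1%:R - kappa * (2 * N)%:R| * delta R 0 x.2) (0%N, 0)
    <= eps * Num.sqrt N%:R.
Proof.
move=> eps0.
have C0 := CK_gt0.
(* the last stretch has length about [2 * e ^+ 2 * N], and both errors are then
   of order [e * sqrt N] *)
pose e := eps / (10 * CK + 2 * eps).
have den : 0 < 10 * CK + 2 * eps by lra.
have e0 : 0 < e by rewrite divr_gt0.
have ee : e * (10 * CK + 2 * eps) = eps by rewrite divfK // gt_eqF.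
have e2 : e <= 2^-1.
  by rewrite ler_pdivrMr //; lra.
have ee0 : 0 < e ^+ 2 by rewrite exprn_gt0.
have [n1 hn1] := count_mean p_gt0 p_le2 gamma_gt1 mean_pos mean_neg ee0.
exists (n1 + (Num.truncn (1 / e ^+ 2)).+1)%N => N hN.
have NL : 1 <= e ^+ 2 * N%:R.
  rewrite mulrC -ler_pdivrMr //; apply: truncn_large; exact: leq_trans (leq_addl _ _) hN.
have N0 : (0 < N)%N by apply: leq_trans hN; rewrite addnS.
have n1N : (n1 <= N)%N := leq_trans (leq_addr _ _) hN.
have NR : 0 < N%:R :> R by rewrite ltr0n.
pose l := (Num.truncn (e ^+ 2 * N%:R)).+1.
have l1 : e ^+ 2 * N%:R <= l%:R by apply: truncn_large.
have l2 : l%:R <= 2 * (e ^+ 2 * N%:R).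
  have : (Num.truncn (e ^+ 2 * N%:R))%:R <= e ^+ 2 * N%:R by rewrite truncn_le; lra.
  by rewrite /l -natr1; lra.
have e22 : 2 * e ^+ 2 <= 2^-1 by rewrite expr2; nra.
have lN : (2 * l <= N)%N.
  rewrite -(ler_nat R) natrM; have := ler_wpM2r (ltW NR) e22; lra.
clearbody l.
pose n := (2 * N - 2 * l)%N.
have nn1 : (n1 <= n)%N by rewrite /n; clear -n1N lN; lia.
have nl : (2 * N = n + 2 * l)%N by rewrite /n; clear -lN; lia.
have nN : (n <= 2 * N)%N by rewrite /n; clear -lN; lia.
clearbody n; clear hN.
have sN : 0 < Num.sqrt N%:R :> R by rewrite sqrtr_gt0.
have sl : e * Num.sqrt N%:R <= Num.sqrt l%:R.
  by rewrite -[e]ger0_norm ?(ltW e0) // -sqrtr_sqr -sqrtrM ?sqr_ge0 // ler_wsqrtr.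
have esN : 0 < e * Num.sqrt N%:R by rewrite mulr_gt0.
pose F (h : nat) : R := `|h%:R - kappa * (2 * N)%:R|.
pose G (h : nat) : R := `|h%:R - kappa * n%:R| + 4 * l%:R.
have FG h' h : (h' <= h <= h' + 2 * l)%N -> F h <= G h'.
  move=> /andP[h1 h2]; rewrite /F /G nl natrD.
  have hh1 : h'%:R <= h%:R :> R by rewrite ler_nat.
  have hh2 : h%:R <= h'%:R + 2 * l%:R :> R by rewrite -natrM -natrD ler_nat.
  have -> : h%:R - kappa * (n%:R + (2 * l)%:R) =
    (h'%:R - kappa * n%:R) + (h%:R - h'%:R - kappa * (2 * l)%:R) by ring.
  apply: le_trans (ler_normD _ _) _; rewrite lerD2l natrM ler_norml.
  have lR : 0 <= l%:R :> R by [].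
  have k0 := kappa_gt0; have k1 := kappa_lt1.
  have := mulr_ge0 (ltW k0) lR; have := ler_wpM2r lR (ltW k1).
  by rewrite mul1r => ? ?; apply/andP; split; lra.
rewrite {1}nl; apply: le_trans (count_split n FG) _.
have -> : count p n (fun y => G y.1 * vert p (2 * l) (delta R 0) y.2) (0%N, 0) =
   count p n (fun y => `|y.1%:R - kappa * n%:R| * vert p (2 * l) (delta R 0) y.2) (0%N, 0)
   + 4 * l%:R * u N.
  rewrite /u /vert nl expect_add -/(vert p) -(count_vert p n _ (0%N, 0)).
  by rewrite /count -expectZ -expectD; apply: eq_expect => y; rewrite /G mulrDl.
have T1 : count p n (fun y => `|y.1%:R - kappa * n%:R| * vert p (2 * l) (delta R 0) y.2) (0%N, 0)
    <= 2 * CK * e * Num.sqrt N%:R.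
  apply: le_trans (_ : CK / (e * Num.sqrt N%:R) *
      count p n (fun y => `|y.1%:R - kappa * n%:R|) (0%N, 0) <= _).
    rewrite /count -expectZ; apply: ler_expect => // y; rewrite mulrC.
    by apply: ler_wpM2r => //; exact: vert_sup.
  apply: le_trans (_ : CK / (e * Num.sqrt N%:R) * (e ^+ 2 * (2 * N%:R)) <= _).
    apply: ler_wpM2l; first by rewrite divr_ge0 ?ltW.
    apply: le_trans (hn1 n nn1) _; rewrite ler_pM2l //.
    by rewrite -natrM ler_nat.
  rewrite -[X in 2 * X](@sqr_sqrtr R N%:R) //.
  by rewrite le_eqVlt; apply/orP; left; apply/eqP; field; rewrite !gt_eqF.
have T2 : 4 * l%:R * u N <= 8 * CK * e * Num.sqrt N%:R.
  apply: le_trans (_ : 4 * (2 * (e ^+ 2 * N%:R)) * (CK / Num.sqrt N%:R) <= _).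
    apply: ler_pM; [by rewrite mulr_ge0|exact: vert_delta_ge0| |exact: return_bound].
    by rewrite ler_pM2l.
  rewrite -[X in e ^+ 2 * X](@sqr_sqrtr R N%:R) //.
  have -> : 4 * (2 * (e ^+ 2 * Num.sqrt N%:R ^+ 2)) * (CK / Num.sqrt N%:R) =
    8 * CK * e * Num.sqrt N%:R * e by field; rewrite gt_eqF.
  apply: ler_piMr; last by apply: le_trans e2 _; rewrite invf_le1 //; lra.
  exact: (mulr_ge0 (mulr_ge0 (mulr_ge0 (ler0n _ 8) (ltW C0)) (ltW e0)) (ltW sN)).
have : 10 * CK * e * Num.sqrt N%:R <= eps * Num.sqrt N%:R.
  rewrite ler_pM2r // -[leRHS]ee mulrDr [e * (10 * CK)]mulrC lerDl.
  exact: (mulr_ge0 (ltW e0) (mulr_ge0 (ler0n _ 2) (ltW eps0))).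
lra.
Qed.

End Conditioned.

(** * Return to the origin *)

Section Origin.
Variables (R : realType) (p : int -> R).
Hypothesis p_gt0 : forall j, 0 < p j.
Hypothesis p_le2 : forall j, p j <= 2^-1.
Let p_ge0 j : 0 <= p j. Proof. exact: ltW. Qed.
Variable omega : R.
Hypothesis omega_gt0 : 0 < omega.
Hypothesis p_ge : forall j, omega <= p j.
Variable gamma : R.
Hypothesis gamma_gt1 : 1 < gamma.
Hypothesis mean_pos : mean_to_zero (fun i => (p i%:Z)^-1 - 2 * gamma).
Hypothesis mean_neg : mean_to_zero (fun i => (p (- i%:Z))^-1 - 2 * gamma).

Let u n := vert p (2 * n) (delta R 0) 0.
Let a n := count p (2 * n) (fun x => ret R x.1 * delta R 0 x.2) (0%N, 0).
Let kappa := 1 - gamma^-1.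

(** Replacing [ret] by its typical value [(sqrt (pi * kappa * N))^-1] costs, by
    [ret_approx], three errors: few horizontal steps, deviation from the typical
    number, and the error in the asymptotics of [ret].  The fraction [s ^+ 2]
    separating few from many must be chosen first, since the constant in front
    of the deviation depends on it. *)
Lemma origin_return_close eps : 0 < eps -> exists n0 : nat, forall N, (n0 <= N)%N ->
  `|N%:R * (a N - (Num.sqrt (pi * kappa * N%:R))^-1 * u N)| <= eps.
Proof.
move=> eps0.
have kap0 : 0 < kappa by rewrite /kappa subr_gt0 invf_lt1 // (lt_trans ltr01).
have pk : 0 < Num.sqrt (pi * kappa) by rewrite sqrtr_gt0 mulr_gt0 ?pi_gt0.
pose C1 := 2 + 2 / Num.sqrt (pi * kappa).
have C10 : 0 < C1 by rewrite addr_gt0 // divr_gt0.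
have [C C0 hC] := few_horizontal p_gt0 p_le2 omega_gt0 p_ge gamma_gt1 mean_pos mean_neg.
pose s := eps / (9 * C1 * C).
have s0 : 0 < s by rewrite divr_gt0 // !mulr_gt0.
have sC : C1 * (3 * C * s) = eps / 3 by rewrite /s; field; rewrite !gt_eqF.
have eta0 : 0 < s ^+ 2 by rewrite exprn_gt0.
pose D := (2 * kappa * Num.sqrt (s ^+ 2 / 2))^-1.
have D0 : 0 < D by rewrite invr_gt0 !mulr_gt0 // sqrtr_gt0 divr_gt0.
pose CK := (omega ^+ 2)^-1.
have CK0 : 0 < CK by rewrite invr_gt0 exprn_gt0.
have e30 : 0 < eps / (3 * CK) by rewrite divr_gt0 // mulr_gt0.
have e20 : 0 < eps / (3 * D) by rewrite divr_gt0 // mulr_gt0.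
have [n1 hn1] := ret_approx kap0 eta0 e30.
have [n2 hn2] :=
  horizontal_concentration p_gt0 p_le2 omega_gt0 p_ge gamma_gt1 mean_pos mean_neg e20.
exists (n1 + n2 + (Num.truncn (1 / s ^+ 2)).+2)%N => N hN.
have n1N : (n1 <= N)%N by apply: leq_trans hN; rewrite -addnA leq_addr.
have n2N : (n2 <= N)%N by apply: leq_trans hN; rewrite addnAC leq_addl.
have N2 : (2 <= N)%N by apply: leq_trans hN; rewrite !addnS.
have NL : 1 <= s ^+ 2 * N%:R.
  rewrite mulrC -ler_pdivrMr //; apply: truncn_large.
  by apply: leq_trans hN; apply: leq_trans (leqnSn _) (leq_addl _ _).
have {hN} N0 : (0 < N)%N := ltnW N2.
have NR : 0 < N%:R :> R by rewrite ltr0n.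
have sN : 0 < Num.sqrt N%:R :> R by rewrite sqrtr_gt0.
pose M := (Num.truncn (s ^+ 2 * N%:R)).+1.
pose X := count p (2 * N) (fun x => inv_sqrt_below R M x.1 * delta R 0 x.2) (0%N, 0).
pose Y := count p (2 * N) (fun x => `|x.1%:R - kappa * (2 * N)%:R| * delta R 0 x.2) (0%N, 0).
set q := (Num.sqrt (pi * kappa * N%:R))^-1.
have main : `|a N - q * u N| <= C1 * X + D / (N%:R * Num.sqrt N%:R) * Y
    + eps / (3 * CK) / Num.sqrt N%:R * u N.
  have -> : a N - q * u N = count p (2 * N) (fun x => (ret R x.1 - q) * delta R 0 x.2) (0%N, 0).
    rewrite /a /u -[0 in RHS]/(0%N, 0 : int).2.
    rewrite -(count_vert p (2 * N) (delta R 0) (0%N, 0)) -mulNr /count -expectZ -expectD.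
    by apply: eq_expect => x; rewrite mulrBl mulNr.
  rewrite /count; apply: le_trans; first by apply: expect_abs_le => x; [exact: p_ge0|exact: p_le2].
  apply: le_trans (_ : count p (2 * N) (fun x =>
     (C1 * inv_sqrt_below R M x.1 + D / (N%:R * Num.sqrt N%:R) * `|x.1%:R - kappa * (2 * N)%:R|
      + eps / (3 * CK) / Num.sqrt N%:R) * delta R 0 x.2) (0%N, 0) <= _).
    apply: (ler_count_reach p_gt0 p_le2) => h j hN.
    rewrite /= normrM [`|delta _ _ _|]ger0_norm ?delta_ge0 // => par.
    case: (eqVneq j 0) par => [->|j0] par; last by rewrite /delta (negbTE j0) !mulr0.
    apply: ler_wpM2r; first exact: delta_ge0.
    have hh : (h = 2 * (h %/ 2))%N by move: par; clear; lia.
    rewrite hh; have hk : (h %/ 2 <= N)%N by move: hN; clear; lia.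
    by have := hn1 N (h %/ 2)%N n1N hk; rewrite [_ * `|_| / _]mulrAC.
  rewrite /X /Y /u -(count_vert p (2 * N) (delta R 0) (0%N, 0)) /count -!expectZ -!expectD.
  apply: ler_expect => // x; rewrite le_eqVlt; apply/orP; left; apply/eqP; ring.
have NX : N%:R * X <= 3 * C * s.
  have sM : 1 + Num.sqrt M%:R <= 3 * s * Num.sqrt N%:R.
    have ssN : s ^+ 2 * N%:R = (s * Num.sqrt N%:R) ^+ 2 by rewrite [RHS]exprMn sqr_sqrtr.
    have sN0 : 0 <= s * Num.sqrt N%:R by rewrite mulr_ge0 // ltW.
    have h1 : 1 <= s * Num.sqrt N%:R.
      by rewrite -ler_sqr ?nnegrE // expr1n -ssN.
    have h2 : Num.sqrt M%:R <= 2 * (s * Num.sqrt N%:R).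
      have q0 : 0 <= 2 * (s * Num.sqrt N%:R) by rewrite mulr_ge0.
      rewrite -ler_sqr ?nnegrE ?sqrtr_ge0 //.
      rewrite sqr_sqrtr // exprMn -ssN.
      have : (Num.truncn (s ^+ 2 * N%:R))%:R <= s ^+ 2 * N%:R by rewrite truncn_le; lra.
      by rewrite /M -[(Num.truncn _).+1%:R]natr1; lra.
    lra.
  have := hC N M N2 isT; rewrite -/X => h.
  rewrite -(ler_pM2r sN); have := ler_wpM2l (ltW C0) sM; lra.
have NY : Y <= eps / (3 * D) * Num.sqrt N%:R := hn2 N n2N.
have uN : u N <= CK / Num.sqrt N%:R := return_bound p_gt0 p_le2 omega_gt0 p_ge N0.
rewrite normrM (gtr0_norm NR).
apply: le_trans (ler_wpM2l (ltW NR) main) _.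
have T1 : N%:R * (C1 * X) <= eps / 3.
  by rewrite -sC mulrCA ler_pM2l.
have T2 : N%:R * (D / (N%:R * Num.sqrt N%:R) * Y) <= eps / 3.
  have -> : N%:R * (D / (N%:R * Num.sqrt N%:R) * Y) = D / Num.sqrt N%:R * Y.
    by field; rewrite !gt_eqF.
  apply: le_trans (ler_wpM2l _ NY) _; first by rewrite divr_ge0 // ltW.
  by rewrite le_eqVlt; apply/orP; left; apply/eqP; field; rewrite !gt_eqF.
have T3 : N%:R * (eps / (3 * CK) / Num.sqrt N%:R * u N) <= eps / 3.
  rewrite mulrA; apply: le_trans (ler_wpM2l _ uN) _.
    by rewrite mulr_ge0 // divr_ge0 // ltW.
  have NE : N%:R = Num.sqrt N%:R * Num.sqrt N%:R :> R by rewrite -expr2 sqr_sqrtr.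
  rewrite {1}NE.
  by rewrite le_eqVlt; apply/orP; left; apply/eqP; field; rewrite !gt_eqF.
lra.
Qed.

Variable K : R.
Hypothesis even_odd : forall N, (0 < N)%N ->
  \sum_(1 <= m < N.+1) (vert p (2 * m + 2) (delta R 0) 0 - vert p (2 * m + 1) (delta R 0) 0) <= K.

Lemma origin_return_cvg :
  N%:R * a N @[N --> \oo] --> (4 * p 0 * pi * Num.sqrt (gamma - 1))^-1.
Proof.
have g0 : 0 < gamma by exact: lt_trans ltr01 _.
have kap0 : 0 < kappa by rewrite /kappa subr_gt0 invf_lt1.
have pi0 := @pi_gt0 R.
have cl : N%:R * (a N - (Num.sqrt (pi * kappa * N%:R))^-1 * u N) @[N --> \oo] --> (0 : R).
  apply/cvg_seqP => eps eps0; have [n0 hn0] := origin_return_close eps0.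
  by exists n0 => N nN; rewrite subr0; exact: hn0.
have uc := return_cvg p_gt0 p_le2 gamma_gt1 mean_pos mean_neg even_odd.
have h := cvgD cl (cvgM uc (cvg_cst ((Num.sqrt (pi * kappa))^-1))).
rewrite add0r in h.
have -> : (4 * p 0 * pi * Num.sqrt (gamma - 1))^-1 =
    (4 * p 0 * Num.sqrt (pi * gamma))^-1 / Num.sqrt (pi * kappa).
  rewrite -invfM -mulrA -[in RHS](mulrA (4 * p 0)) -sqrtrM ?mulr_ge0 ?(ltW pi0) ?(ltW g0) //.
  have -> : pi * gamma * (pi * kappa) = pi ^+ 2 * (gamma - 1).
    by rewrite /kappa; field; rewrite gt_eqF.
  by rewrite sqrtrM ?sqr_ge0 // sqrtr_sqr ger0_norm // ltW.
apply: cvg_trans; last exact: h.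
apply: near_eq_cvg; exists 1%N => // N /= N1.
have NR : 0 < N%:R :> R by rewrite ltr0n.
transitivity (N%:R * (a N - (Num.sqrt (pi * kappa * N%:R))^-1 * u N) +
  u N * Num.sqrt N%:R / Num.sqrt (pi * kappa)); first by [].
have sN : 0 < Num.sqrt N%:R :> R by rewrite sqrtr_gt0.
have pk0 : 0 < pi * kappa by rewrite mulr_gt0.
have spk : 0 < Num.sqrt (pi * kappa) by rewrite sqrtr_gt0.
rewrite sqrtrM ?(ltW pk0) // -[X in X * (_ - _)](@sqr_sqrtr R N%:R) //.
rewrite -[X in _ = X * _](@sqr_sqrtr R N%:R) //.
by field; rewrite !gt_eqF.
Qed.

End Origin.

Lemma mean_to_zero_littleo (R : realType) (f : nat -> R) (c eta : R) : 0 < eta ->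
  (fun n : nat => n%:R^-1 * (\sum_(1 <= j < n.+1) f j) : R) =
    (fun _ : nat => c : R) +o_\oo (fun n : nat => n%:R `^ (- eta) : R) ->
  mean_to_zero (fun i => f i - c).
Proof.
move=> eta0 /eqaddoP fo eps eps0.
have [n0 _ hn0] := fo _ eps0.
exists n0.+1 => n hn.
have n1 : (0 < n)%N by lia.
have nR : 0 < n%:R :> R by rewrite ltr0n.
have := hn0 n ltac:(rewrite /=; lia); rewrite /= !fctE /=.
set S := \sum_(1 <= j < n.+1) f j => h.
have -> : \sum_(1 <= i < n.+1) (f i - c) = n%:R * (n%:R^-1 * S - c).
  rewrite sumrB -/S sumr_const_nat subn1 /= mulrBr mulrA mulfV ?gt_eqF // mul1r.
  by rewrite mulr_natl.
rewrite normrM (gtr0_norm nR) mulrC ler_pM2r //; apply: le_trans h _.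
rewrite ler_piMr ?(ltW eps0) // ger0_norm ?powR_ge0 //.
rewrite -[leRHS](@powRr0 R n%:R); apply: ler_powR; first by rewrite ler1n.
by rewrite oppr_le0 ltW.
Qed.

(** Obtained from the instance [n = 1], the first one where the factor [sqrt n]
    is not zero. *)
Lemma even_odd_le (R : realType) (v : nat -> R) :
  (ereal_sup [set
     (Num.sqrt (n%:R : R))%:E *
     ereal_sup [set (\sum_(n <= m < N.+1) (v (2 * m + 2)%N - v (2 * m + 1)%N)%R)%:E
       | N in [set N : nat | (n <= N)%N]]
     | n in [set: nat]] < +oo)%E ->
  exists K : R, forall N, (0 < N)%N ->
    \sum_(1 <= m < N.+1) (v (2 * m + 2)%N - v (2 * m + 1)%N) <= K.
Proof.
set A := [set _ | n in _]; move=> supA.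
set B := [set (\sum_(1%N <= m < N.+1) (v (2 * m + 2)%N - v (2 * m + 1)%N)%R)%:E
       | N in [set N : nat | (1 <= N)%N]].
have BA : (ereal_sup B <= ereal_sup A)%E.
  apply: ereal_sup_ubound; exists 1%N => //=.
  by rewrite sqrtr1 mul1e.
have hB N : (0 < N)%N ->
    ((\sum_(1 <= m < N.+1) (v (2 * m + 2)%N - v (2 * m + 1)%N)%R)%:E <= ereal_sup A)%E.
  by move=> N0; apply: le_trans BA; apply: ereal_sup_ubound; exists N.
case: (ereal_sup A) supA hB => [r _ hB|//|_ hB].
  by exists r => N N0; rewrite -lee_fin; exact: hB.
by exists 0 => N N0; have := hB N N0.
Qed.

Theorem theorem1p1 (R : realType) (d : measure_display) (T : measurableType d)
    (P : probability T R) (p : int -> R) (C : nat -> T -> int * int)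
    (gamma eta : R)
    (hp : forall j : int, 0 < p j <= 2^-1)
    (hmin : inf [set p j | j in [set: int]] < 2^-1)
    (hC : anisotropic_walk P p C)
    (hgamma : 1 < gamma)
    (heta : 2^-1 < eta)
    (hi_pos :
      (fun n : nat => n%:R^-1 * (\sum_(1 <= j < n.+1) (p (j%:Z))^-1) : R) =
        (fun _ : nat => 2 * gamma : R) +o_\oo (fun n : nat => n%:R `^ (- eta) : R))
    (hi_neg :
      (fun n : nat => n%:R^-1 * (\sum_(1 <= j < n.+1) (p (- j%:Z))^-1) : R) =
        (fun _ : nat => 2 * gamma : R) +o_\oo (fun n : nat => n%:R `^ (- eta) : R))
    (hii : exists2 omega : R, 0 < omega & forall j : int, omega <= p j)
    (hiii :
      (ereal_sup [set
         (Num.sqrt (n%:R : R))%:E *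
         ereal_sup [set
           (\sum_(n <= m < N.+1)
              (Pr P [set t | (C (2 * m + 2)%N t).2 = 0]
               - Pr P [set t | (C (2 * m + 1)%N t).2 = 0])%R)%:E
           | N in [set N : nat | (n <= N)%N]]
         | n in [set: nat]] < +oo)%E) :
  (fun N : nat =>
     Pr P [set t | C (2 * N)%N t = (0, 0)]
     / (1 / (4 * N%:R * p 0 * pi * Num.sqrt (gamma - 1))))
    @ \oo --> (1 : R).
Proof.
have p_gt0 j : 0 < p j by have /andP[] := hp j.
have p_le2 j : p j <= 2^-1 by have /andP[] := hp j.
have eta0 : 0 < eta by apply: lt_trans heta; rewrite invr_gt0.
have mean_pos := mean_to_zero_littleo eta0 hi_pos.
have mean_neg := mean_to_zero_littleo eta0 hi_neg.
have [omega omega0 p_ge] := hii.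
have [K hK] := @even_odd_le R (fun n => Pr P [set t | (C n t).2 = 0]) hiii.
have even_odd N : (0 < N)%N ->
    \sum_(1 <= m < N.+1) (vert p (2 * m + 2) (delta R 0) 0 - vert p (2 * m + 1) (delta R 0) 0) <= K.
  move=> /hK; apply: le_trans; rewrite le_eqVlt; apply/orP; left; apply/eqP.
  by apply: eq_bigr => m _; rewrite !(Pr_vertical _ hC).
have cv := origin_return_cvg p_gt0 p_le2 omega0 p_ge hgamma mean_pos mean_neg even_odd.
set c := 4 * p 0 * pi * Num.sqrt (gamma - 1) in cv.
have c0 : 0 < c.
  by rewrite !mulr_gt0 ?pi_gt0 ?p_gt0 // sqrtr_gt0 subr_gt0.
have h := cvgM cv (cvg_cst c).
rewrite mulVf ?gt_eqF // in h.
apply: cvg_trans; last exact: h.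
apply: near_eq_cvg; apply: nearW => N.
rewrite (Pr_origin _ hC) div1r invrK.
transitivity (N%:R * count p (2 * N) (fun x => ret R x.1 * delta R 0 x.2) (0%N, 0) * c);
  first by [].
rewrite /c; ring.
Qed.
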